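(* Let $k$ be an algebraically closed field of characteristic $p>3$, let $\mathfrak{g}=W_1$ be the Witt algebra over $k$, and let $\mathscr{N}=\{x\in\mathfrak{g}\mid x^{[p]}=0\}$ be its nilpotent variety. Then the nilpotent commuting variety $\mathscr{C}(\mathscr{N})=\{(x,y)\in\mathscr{N}\times\mathscr{N}\mid [x,y]=0\}$ is reducible and equidimensional. More precisely, $$\mathscr{C}(\mathscr{N})=\bigcup_{i=0}^{(p-3)/2}\mathfrak{C}(i)$$ is the decomposition of $\mathscr{C}(\mathscr{N})$ into irreducible components, where $\mathfrak{C}(0)$ is the Zariski closure of $\{(x,ax)\mid x\in\mathscr{N},\,a\in k\}$ and, for $i\geq 1$, $\mathfrak{C}(i)$ is the Zariski closure of $\{(x,y)\in\mathscr{N}\times\mathscr{N}\mid x\in\mathfrak{g}_i\setminus\mathfrak{g}_{i+1},\,[x,y]=0\}$.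
   Context: Let $\mathfrak{A}=k[X]/(X^p)$ and let $D$ be the derivation of $\mathfrak{A}$ with $D(X^i)=iX^{i-1}$ for $0\le i\le p-1$. The Witt algebra $W_1$ is the Lie algebra of $k$-linear derivations of $\mathfrak{A}$, with basis $X^iD$, $0\le i\le p-1$; it is a restricted Lie algebra whose $[p]$-map is the $p$-th power of derivations as linear operators. Set $\mathfrak{g}_{[j]}=kX^{j+1}D$ for $-1\le j\le p-2$ and $\mathfrak{g}_i=\sum_{j\ge i}\mathfrak{g}_{[j]}$ for $i\geq -1$ (so $\mathfrak{g}_{p-1}=0$). Varieties are Zariski closed subsets of finite-dimensional affine spaces over $k$; the closures are taken in $\mathfrak{g}\times\mathfrak{g}$. Equidimensional means that all irreducible components have the same dimension. ''The decomposition into irreducible components'' means that the $\mathfrak{C}(i)$, $0\le i\le (p-3)/2$, are pairwise distinct and are exactly the irreducible components. *)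

(* Defs.v *)
From HB Require Import structures.
From mathcomp Require Import all_boot all_order all_algebra all_field.
From mathcomp Require Import qpoly mpoly.
From mathcomp Require Import boolp classical_sets.

Set Implicit Arguments.
Unset Strict Implicit.
Unset Printing Implicit Defensive.

Import GRing.Theory.
Local Open Scope ring_scope.
Local Open Scope classical_set_scope.

Definition coords (k : fieldType) (V : vectType k) (v : V) :
    'I_(\dim {:V}) -> k :=
  fun i => coord (vbasis {:V}) i v.

Definition zclosed (k : fieldType) (V : vectType k) (Z : set V) : Prop :=
  exists P : set {mpoly k[\dim {:V}]},
    Z = [set v | forall f, P f -> f.@[coords v] = 0].

Definition zclosure (k : fieldType) (V : vectType k) (S : set V) : set V :=
  smallest (@zclosed k V) S.

Definition zirreducible (k : fieldType) (V : vectType k) (Y : set V) : Prop :=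
  Y !=set0 /\
  forall A B : set V, zclosed A -> zclosed B ->
    Y `<=` A `|` B -> Y `<=` A \/ Y `<=` B.

Definition irr_component (k : fieldType) (V : vectType k) (Z Y : set V) : Prop :=
  [/\ Y `<=` Z, zirreducible Y &
      forall Y' : set V, zirreducible Y' -> Y `<=` Y' -> Y' `<=` Z -> Y' = Y].

(** Krull dimension; [Z] is meant to be closed, so that being closed in [Z]
    amounts to being closed in [V]. *)

Definition irr_chain (k : fieldType) (V : vectType k) (Z : set V) (n : nat) :
    Prop :=
  exists Y : nat -> set V,
    (forall i, (i <= n)%N -> [/\ zclosed (Y i), zirreducible (Y i) & Y i `<=` Z])
    /\ (forall i, (i < n)%N -> Y i `<` Y i.+1).

Definition zdim_is (k : fieldType) (V : vectType k) (Z : set V) (d : nat) : Prop :=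
  irr_chain Z d /\ forall n, irr_chain Z n -> (n <= d)%N.

Definition equidimensional (k : fieldType) (V : vectType k) (Z : set V) : Prop :=
  exists d : nat, forall Y : set V, irr_component Z Y -> zdim_is Y d.

Notation trunc_poly k p := {poly %/ ('X^p : {poly k})}.

(** The Leibniz defect [a, b |-> f (a b) - (f a) b - a (f b)] of [f]; the
    derivations are the kernel of this map, see [derivationsP]. *)

Definition leibniz2 (k : fieldType) (p : nat) (f : 'End(trunc_poly k p))
    (a b : trunc_poly k p) : trunc_poly k p :=
  f (a * b) - (f a * b + a * f b).

Fact leibniz2_is_linear (k : fieldType) (p : nat) (f : 'End(trunc_poly k p))
    (a : trunc_poly k p) : linear (leibniz2 f a).
Proof.
move=> c x y; rewrite /leibniz2 mulrDr -scalerAr 2!linearP mulrDr -scalerAr.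
rewrite mulrDr -scalerAr scalerBr scalerDr.
rewrite -addrA -[RHS]addrA; congr (_ + _).
rewrite [in RHS]addrCA; congr (_ + _).
by rewrite -opprD addrACA.
Qed.

HB.instance Definition _ (k : fieldType) (p : nat) (f : 'End(trunc_poly k p))
    (a : trunc_poly k p) :=
  GRing.isLinear.Build k (trunc_poly k p) (trunc_poly k p) _ (leibniz2 f a)
    (@leibniz2_is_linear k p f a).

Definition leibniz1 (k : fieldType) (p : nat) (f : 'End(trunc_poly k p))
    (a : trunc_poly k p) : 'End(trunc_poly k p) :=
  linfun (leibniz2 f a).

Fact leibniz1_is_linear (k : fieldType) (p : nat) (f : 'End(trunc_poly k p)) :
  linear (leibniz1 f).
Proof.
have sym a b : leibniz2 f a b = leibniz2 f b a.
  by rewrite /leibniz2 [b * a]mulrC [f b * a]mulrC [b * f a]mulrC [X in _ - X]addrC.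
move=> c a b; apply/lfunP=> x; rewrite add_lfunE scale_lfunE !lfunE /=.
by rewrite ![leibniz2 _ _ x]sym linearP.
Qed.

HB.instance Definition _ (k : fieldType) (p : nat) (f : 'End(trunc_poly k p)) :=
  GRing.isLinear.Build k (trunc_poly k p) 'End(trunc_poly k p) _ (leibniz1 f)
    (@leibniz1_is_linear k p f).

Definition leibniz (k : fieldType) (p : nat) (f : 'End(trunc_poly k p)) :
    'Hom(trunc_poly k p, 'End(trunc_poly k p)) :=
  linfun (leibniz1 f).

Fact leibniz_is_linear (k : fieldType) (p : nat) : linear (@leibniz k p).
Proof.
move=> c f g; apply/lfunP=> a; apply/lfunP=> b.
rewrite !(add_lfunE, scale_lfunE, lfunE) /=.
rewrite /leibniz2 !(add_lfunE, scale_lfunE) !(mulrDl, mulrDr).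
rewrite -scalerAr -scalerAl scalerBr scalerDr [RHS]addrACA -opprD.
by congr (_ - _); rewrite [LHS]addrACA.
Qed.

HB.instance Definition _ (k : fieldType) (p : nat) :=
  GRing.isLinear.Build k 'End(trunc_poly k p)
    'Hom(trunc_poly k p, 'End(trunc_poly k p)) _ (@leibniz k p)
    (@leibniz_is_linear k p).

Definition derivations (k : fieldType) (p : nat) :
    {vspace 'End(trunc_poly k p)} :=
  lker (linfun (@leibniz k p)).

Lemma derivationsP (k : fieldType) (p : nat) (f : 'End(trunc_poly k p)) :
  reflect (forall a b, f (a * b) = f a * b + a * f b) (f \in derivations k p).
Proof.
rewrite memv_ker lfunE /=; apply: (iffP eqP) => [f0 a b | fM].
  move/lfunP/(_ a)/lfunP/(_ b): f0; rewrite !lfunE /= => /eqP.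
  by rewrite /leibniz2 subr_eq0 => /eqP.
apply/lfunP=> a; apply/lfunP=> b; rewrite !lfunE /=.
by rewrite /leibniz2 fM subrr.
Qed.

(** On representatives of degree [< p], [D (X^i) = i X^(i-1)] is the formal
    derivative. *)

Definition dX_fun (k : fieldType) (p : nat) (a : trunc_poly k p) :
    trunc_poly k p :=
  in_qpoly 'X^p (a : {poly k})^`().

Fact dX_is_linear (k : fieldType) (p : nat) : linear (@dX_fun k p).
Proof. by move=> c a b; rewrite /dX_fun -in_qpolyZ -in_qpolyD -derivZ -derivD. Qed.

HB.instance Definition _ (k : fieldType) (p : nat) :=
  GRing.isLinear.Build k (trunc_poly k p) (trunc_poly k p) _ (@dX_fun k p)
    (@dX_is_linear k p).

Definition XD_fun (k : fieldType) (p m : nat) (a : trunc_poly k p) :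
    trunc_poly k p :=
  'qX ^+ m * dX_fun a.

Fact XD_is_linear (k : fieldType) (p m : nat) : linear (@XD_fun k p m).
Proof. by move=> c a b; rewrite /XD_fun linearP mulrDr -scalerAr. Qed.

HB.instance Definition _ (k : fieldType) (p m : nat) :=
  GRing.isLinear.Build k (trunc_poly k p) (trunc_poly k p) _ (@XD_fun k p m)
    (@XD_is_linear k p m).

Definition XD (k : fieldType) (p m : nat) : 'End(trunc_poly k p) :=
  linfun (@XD_fun k p m).

Lemma mk_monic_Xp (k : fieldType) (p : nat) :
  (0 < p)%N -> mk_monic 'X^p = 'X^p :> {poly k}.
Proof. by rewrite /mk_monic size_polyXn ltnS monicXn => ->. Qed.

Lemma dX_funM (k : fieldType) (p : nat) (a b : trunc_poly k p) :
  p \in [pchar k] -> dX_fun (a * b) = dX_fun a * b + a * dX_fun b.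
Proof.
move=> pk; have p0 : (0 < p)%N by exact/prime_gt0/(pcharf_prime pk).
have inK (c : trunc_poly k p) : in_qpoly 'X^p (c : {poly k}) = c.
  by apply/val_inj/in_qpoly_small/size_mk_monic.
rewrite -{2}[b]inK -{3}[a]inK /dX_fun -!in_qpolyM -in_qpolyD -derivM.
rewrite poly_of_qpolyM; move: (_ * _ : {poly k}) => ab; rewrite mk_monic_Xp //.
rewrite [in RHS](Pdiv.RingMonic.rdivp_eq (monicXn k p) ab) derivD derivM.
rewrite derivXn -mulr_natr (_ : p%:R = 0 :> {poly k}); last first.
  by rewrite -polyC_natr (pcharf0 pk).
rewrite mulr0 mulr0 addr0 in_qpolyD in_qpolyM.
suff -> : in_qpoly 'X^p ('X^p : {poly k}) = 0 by rewrite mulr0 add0r.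
apply/val_inj => /=; rewrite mk_monic_Xp //.
by rewrite Pdiv.RingMonic.rmodpp // monicXn.
Qed.

Lemma XD_derivation (k : fieldType) (p m : nat) :
  p \in [pchar k] -> XD k p m \in derivations k p.
Proof.
move=> pk; apply/derivationsP => a b; rewrite !lfunE /= /XD_fun dX_funM //.
by rewrite mulrDr mulrA [a * (_ * _)]mulrCA.
Qed.

Notation witt k p := (subvs_of (derivations k p)).

(** The bracket and the [p]-map are computed in the endomorphism algebra; the
    projection [vsproj] back to [witt k p] is harmless by [val_lie_br] and
    [val_pmap], and likewise in [witt_XD] by [val_witt_XD]. *)

Definition lie_br (k : fieldType) (p : nat) (x y : witt k p) : witt k p :=
  vsproj (derivations k p) ((vsval x \o vsval y) - (vsval y \o vsval x))%VF.

Definition pmap (k : fieldType) (p : nat) (x : witt k p) : witt k p :=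
  vsproj (derivations k p) (iter p (comp_lfun (vsval x)) \1%VF).

Definition witt_XD (k : fieldType) (p m : nat) : witt k p :=
  vsproj (derivations k p) (XD k p m).

Lemma val_witt_XD (k : fieldType) (p m : nat) :
  p \in [pchar k] -> vsval (witt_XD k p m) = XD k p m.
Proof. by move=> pk; rewrite vsprojK // XD_derivation. Qed.

Lemma val_lie_br (k : fieldType) (p : nat) (x y : witt k p) :
  vsval (lie_br x y) = ((vsval x \o vsval y) - (vsval y \o vsval x))%VF.
Proof.
rewrite vsprojK //; apply/derivationsP => a b.
have /derivationsP xM := subvsP x; have /derivationsP yM := subvsP y.
rewrite !(add_lfunE, opp_lfunE, comp_lfunE) !(xM, yM) !linearD /= !(xM, yM).
rewrite mulrBl mulrBr !opprD.
set u1 := _ * b; set u2 := _ * _; set u3 := _ * _; set u4 := a * _.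
set v1 := _ * b; set v4 := a * _.
rewrite -!addrA; congr (_ + _); rewrite [RHS]addrCA.
rewrite [LHS]addrA [u2 + u3]addrC.
rewrite addrC -!addrA; congr (_ + _).
by congr (_ + _); rewrite addrA -opprD [- v4 + _]addrC addKr.
Qed.

Lemma iter_derivationM (k : fieldType) (p n : nat) (x : 'End(trunc_poly k p))
    (a b : trunc_poly k p) :
  x \in derivations k p ->
  iter n x (a * b) = \sum_(i < n.+1) (iter (n - i) x a * iter i x b) *+ 'C(n, i).
Proof.
move=> /derivationsP xM; elim: n => [|n IHn].
  by rewrite big_ord_recl big_ord0 /= addr0.
rewrite iterS IHn linear_sum /=.
rewrite (eq_bigr (fun i : 'I_n.+1 =>
  (iter (n.+1 - i) x a * iter i x b) *+ 'C(n, i)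
  + (iter (n - i) x a * iter i.+1 x b) *+ 'C(n, i))); last first.
  by move=> i _; rewrite linearMn /= xM mulrnDl subSn // -ltnS.
rewrite big_split /= big_ord_recl [in RHS]big_ord_recl /= !bin0 -addrA.
congr (_ + _); rewrite [in RHS](eq_bigr (fun i : 'I_n.+1 =>
  (iter (n - i) x a * iter i.+1 x b) *+ 'C(n, i.+1)
  + (iter (n - i) x a * iter i.+1 x b) *+ 'C(n, i))); last first.
  by move=> i _; rewrite /bump /= add1n subSS binS mulrnDr.
rewrite big_split /=; congr (_ + _).
by rewrite big_ord_recr /= bin_small // mulr0n addr0.
Qed.

Lemma val_pmap (k : fieldType) (p : nat) (x : witt k p) :
  p \in [pchar k] -> vsval (pmap x) = iter p (comp_lfun (vsval x)) \1%VF.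
Proof.
move=> pk; rewrite vsprojK //; apply/derivationsP => a b.
have itE n c : iter n (comp_lfun (vsval x)) \1%VF c = iter n (vsval x) c.
  by elim: n => [|n IHn] /=; rewrite ?id_lfunE // comp_lfunE IHn.
have p0 : (0 < p)%N by exact/prime_gt0/(pcharf_prime pk).
rewrite !itE.
suff iterM n : n = p -> forall x' : 'End(trunc_poly k p),
    x' \in derivations k p ->
    iter n x' (a * b) = iter n x' a * b + a * iter n x' b.
  by apply: iterM => //; exact: subvsP.
case: n => [p00 | n np x' dx']; first by rewrite -p00 in p0.
rewrite iter_derivationM // big_ord_recr big_ord_recl /= subnn bin0 binn !mulr1n.
rewrite big1 ?addr0 // => i _; rewrite /bump /= add1n.
have /dvdnP[c ->] : (p %| 'C(n.+1, i.+1))%N.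
  by rewrite np; apply: prime_dvd_bin; [exact: pcharf_prime pk | rewrite -np /= ltnS ltn_ord].
rewrite mulrnA -mulr_natr (_ : p%:R = 0) ?mulr0 //.
by rewrite -[p%:R]scaler_nat (pcharf0 pk) scale0r.
Qed.

Lemma in_qpolyXn (k : fieldType) (p n : nat) :
  in_qpoly 'X^p ('X^n : {poly k}) = 'qX ^+ n.
Proof.
elim: n => [|n IHn]; first by rewrite !expr0 in_qpoly1.
by rewrite !exprS in_qpolyM IHn.
Qed.

Lemma derivation_ext (k : fieldType) (p : nat) (f g : 'End(trunc_poly k p)) :
  f \in derivations k p -> g \in derivations k p -> f 'qX = g 'qX -> f = g.
Proof.
move=> df dg fg; apply/eqP; rewrite -subr_eq0; apply/eqP.
have /derivationsP := memvB df dg; have : (f - g) 'qX = 0.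
  by rewrite add_lfunE opp_lfunE fg subrr.
move: (f - g) => h hX hM; apply/lfunP=> a; rewrite zero_lfunE.
have h1 : h 1 = 0.
  by have /eqP := hM 1 1; rewrite !mulr1 mul1r -subr_eq0 opprD addNKr oppr_eq0 => /eqP.
have hXn n : h ('qX ^+ n) = 0.
  elim: n => [|n IHn]; first by rewrite expr0.
  by rewrite exprS hM hX IHn mul0r mulr0 addr0.
have -> : a = in_qpoly 'X^p (a : {poly k}).
  by apply/val_inj/esym/in_qpoly_small/size_mk_monic.
rewrite -[a : {poly k}]coefK poly_def !linear_sum /= big1 // => i _.
by rewrite !linearZ /= in_qpolyXn hXn scaler0.
Qed.

Lemma witt_XD_X (k : fieldType) (p m : nat) :
  p \in [pchar k] -> vsval (witt_XD k p m) 'qX = 'qX ^+ m.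
Proof.
move=> pk; have p1 : (1 < p)%N by exact/prime_gt1/(pcharf_prime pk).
rewrite val_witt_XD // lfunE /= /XD_fun /dX_fun qpolyXE ?size_polyXn ?monicXn //.
by rewrite derivX in_qpoly1 mulr1.
Qed.

Lemma witt_XD_basis (k : fieldType) (p : nat) :
  p \in [pchar k] -> basis_of {: witt k p} [tuple witt_XD k p i | i < p].
Proof.
move=> pk; have p0 : (0 < p)%N by exact/prime_gt0/(pcharf_prime pk).
set X := [tuple _ | i < p].
have sumX (c : 'I_p -> k) :
    vsval (\sum_i c i *: X`_i) 'qX = in_qpoly 'X^p (\poly_(i < p) oapp c 0 (insub i)).
  rewrite linear_sum sum_lfunE poly_def linear_sum /=; apply: eq_bigr => i _.
  rewrite (nth_map i) ?size_enum_ord // nth_ord_enum scale_lfunE witt_XD_X //.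
  by rewrite linearZ /= in_qpolyXn valK.
have size_pX : size (mk_monic ('X^p : {poly k})) = p.+1.
  by rewrite mk_monic_Xp // size_polyXn.
rewrite /basis_of eqEsubv subvf /=; apply/andP; split.
  apply/subvP => x _; pose a : {poly k} := vsval x 'qX.
  have -> : x = \sum_(i < p) a`_i *: X`_i.
    apply/val_inj/derivation_ext; rewrite ?subvsP // sumX.
    apply/val_inj/esym/(etrans (in_qpoly_small _)).
      by rewrite size_pX ltnS size_poly.
    apply/polyP => i; rewrite coef_poly; case: ltnP => [ip | pi].
      by rewrite insubT.
    by rewrite nth_default // (leq_trans _ pi) // -ltnS -size_pX size_mk_monic.
  by apply: memv_suml => i _; apply/memvZ/memv_span/mem_nth; rewrite size_tuple.
apply/(@freeP _ _ p X) => c c0 i; have := sumX c; rewrite c0 zero_lfunE.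
move/(congr1 (fun a : trunc_poly k p => (a : {poly k})`_i)).
rewrite in_qpoly_small ?size_pX ?ltnS ?size_poly // coef_poly ltn_ord valK /=.
by rewrite coef0.
Qed.

(** [witt_filt k p i] is the sum of the [k X^(j+1) D] for [i <= j <= p - 2];
    the summation index is [m = j + 1]. *)

Definition witt_filt (k : fieldType) (p : nat) (i : int) : {vspace witt k p} :=
  (\sum_(m < p | (i <= m%:Z - 1)%R) <[witt_XD k p m]>)%VS.

Definition nilp_var (k : fieldType) (p : nat) : set (witt k p) :=
  [set x | pmap x = 0].

Arguments nilp_var : clear implicits.

Definition nilp_comm_var (k : fieldType) (p : nat) :
    set (witt k p * witt k p)%type :=
  [set xy | [/\ nilp_var k p xy.1, nilp_var k p xy.2 & lie_br xy.1 xy.2 = 0]].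

Arguments nilp_comm_var : clear implicits.

Definition comm_piece (k : fieldType) (p i : nat) :
    set (witt k p * witt k p)%type :=
  if i == 0%N then
    zclosure [set xy | exists x a, nilp_var k p x /\ xy = (x, a *: x)]
  else
    zclosure [set xy | [/\ nilp_var k p xy.1, nilp_var k p xy.2,
      xy.1 \in witt_filt k p i%:Z, xy.1 \notin witt_filt k p (i%:Z + 1)
      & lie_br xy.1 xy.2 = 0]].

Arguments comm_piece : clear implicits.

(* Main.v *)
Require Import Defs.
From HB Require Import structures.
From mathcomp Require Import all_boot all_order all_algebra all_field.
From mathcomp Require Import qpoly mpoly.
From mathcomp Require Import boolp classical_sets.
From mathcomp Require Import zify.

Set Implicit Arguments.
Unset Strict Implicit.
Unset Printing Implicit Defensive.

Import GRing.Theory.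
Local Open Scope ring_scope.
Local Open Scope classical_set_scope.

(** Write an element of the Witt algebra as [f D] with [f] in
    [A = k[X]/(X^p)]; then [[f D, g D] = (f g' - g f') D].  Call order of [f D]
    the order of vanishing of [f] at [0], so that [g_i] consists of the elements
    of order at least [i + 1].  Two computations give all the structure.

    Nilpotency ([nilpP]): [f D] is nilpotent if and only if the coefficient
    [h(f)] of [X^(p-1)] in [f^(p-1)] vanishes.  In [A] one has
    [f^p = f(0)^p], a constant, so the functional
    [a |-> [X^(p-1)] (f^(p-1) a)] kills the image of [f D]: it maps [f a'] to
    [f(0)^p [X^(p-1)] a' = 0].  Let [f(0) <> 0]; then [ker (f D) = k].  If
    [h(f) <> 0], the constants meet the image of [f D] only in [0], and [f D]
    cannot be nilpotent.  If [h(f) = 0], then [f^(p-1)] has a primitive [u], and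
    [f D] maps [u] to the constant [f(0)^p], whence [(f D)^p] kills [u] and is
    zero.  When [f(0) = 0], [h(f)] is a power of [f'(0)].

    Centralizers ([centralizer_coef]): comparing lowest terms, if [x] has order
    [a] and commutes with [y], then [y - c x] has order greater than [p - a] for
    some constant [c].  So over [x] in [g_i] outside [g_(i+1)] the commuting
    pairs are [(x, c x + z)] with [z] in [g_(p-1-i)], and for [i <= (p-3)/2] the
    closure [C(i)] of these pairs is the closure of the image of a polynomial
    map from [k^p].  The same holds for [i = 0], where the nilpotent [f D] with
    [f(0) <> 0] are exactly the [g^(p-1) D] with [g(0) <> 0] and no term
    [X^(p-1)] in [g], and where one needs that these are dense in the nilpotent
    variety ([nilp_dense]): [h] is monic in the coefficient of [X], so a
    polynomial vanishing on [h = 0] wherever [f(0) <> 0] has a power that is a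
    multiple of [h] ([root_specialization]).

    Images of [k^p] are irreducible ([zirreducible_image]) and of dimension at
    most [p], because [p + 1] polynomials in [p] variables are algebraically
    dependent while a chain of [p + 1] strict inclusions would produce
    independent ones ([irr_chain_image]).  The dimension is exactly [p]: [C(i)]
    strictly contains a linear space of dimension [p - 1] for [i > 0], and [C(0)]
    strictly contains a copy of the nilpotent variety, itself strictly containing
    the [(p-2)]-dimensional [g_1].

    The [C(i)] cover ([nilp_comm_union]): a commuting pair that the description
    of centralizers does not put in some [C(i)] is the value at [t = 0] of
    [(x + t y, y)], which for all [t <> 0] lies in one and the same [C(i)].  No
    [C(i)] contains another ([piece_not_sub]): the order of [x] separates small from
    large [i], and the 2 by 2 minors of the coefficients of [(x, y)] below
    degree [p - i] separate large from small [i]. *)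

(** * Polynomial functions and Zariski closure *)

Lemma rmorph_mmap (R S T : comNzRingType) n (phi : {rmorphism S -> T})
    (c : R -> S) (a : 'I_n -> S) (f : {mpoly R[n]}) :
  phi (mmap c a f) = mmap (phi \o c) (phi \o a) f.
Proof.
rewrite /mmap rmorph_sum /=; apply: eq_bigr => m _.
rewrite rmorphM /mmap1 rmorph_prod; congr (_ * _).
by apply: eq_bigr => i _; rewrite rmorphXn.
Qed.

Lemma eq_mmap (R S : comNzRingType) n (c c' : R -> S) (a a' : 'I_n -> S)
    (f : {mpoly R[n]}) :
  c =1 c' -> a =1 a' -> mmap c a f = mmap c' a' f.
Proof.
move=> cc aa; apply: eq_bigr => m _; rewrite cc; congr (_ * _).
exact: mmap1_eq.
Qed.

Lemma meval_mmap (R S : comNzRingType) n (phi : {rmorphism S -> R})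
    (c : R -> S) (a : 'I_n -> S) (f : {mpoly R[n]}) :
  phi \o c =1 id -> phi (mmap c a f) = f.@[phi \o a].
Proof. by move=> pc; rewrite rmorph_mmap; apply: eq_mmap. Qed.

Lemma horner_eq0 (k : closedFieldType) (q : {poly k}) :
  (forall t, q.[t] = 0) -> q = 0.
Proof.
move=> q0; apply/eqP; apply: contraT => /closed_nonrootP[x].
by rewrite rootE q0 eqxx.
Qed.

Lemma horner_ae_eq0 (k : closedFieldType) (q r : {poly k}) :
  r != 0 -> (forall t, r.[t] != 0 -> q.[t] = 0) -> q = 0.
Proof.
move=> r0 qr; have : q * r = 0.
  apply: horner_eq0 => t; rewrite hornerM; have [->|/qr ->] := eqVneq r.[t] 0.
    by rewrite mulr0.
  by rewrite mul0r.
by move/eqP; rewrite mulf_eq0 (negPf r0) orbF => /eqP.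
Qed.

Section PolynomialFunctions.
Variables (k : fieldType) (V : vectType k).

Definition polyfun (g : V -> k) : Prop :=
  exists f : {mpoly k[\dim {:V}]}, forall v, g v = f.@[coords v].

Lemma polyfun_ext g g' : g =1 g' -> polyfun g -> polyfun g'.
Proof. by move=> gg [f fE]; exists f => v; rewrite -gg. Qed.

Lemma polyfun_cst c : polyfun (fun=> c).
Proof. by exists c%:MP => v; rewrite mevalC. Qed.

Lemma polyfunD g h : polyfun g -> polyfun h -> polyfun (fun v => g v + h v).
Proof. by move=> [f fE] [f' fE']; exists (f + f') => v; rewrite mevalD fE fE'. Qed.

Lemma polyfunM g h : polyfun g -> polyfun h -> polyfun (fun v => g v * h v).
Proof. by move=> [f fE] [f' fE']; exists (f * f') => v; rewrite mevalM fE fE'. Qed.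

Lemma polyfunN g : polyfun g -> polyfun (fun v => - g v).
Proof. by move=> [f fE]; exists (- f) => v; rewrite mevalN fE. Qed.

Lemma polyfunB g h : polyfun g -> polyfun h -> polyfun (fun v => g v - h v).
Proof. by move=> pg /polyfunN; exact: polyfunD. Qed.

Lemma polyfunX g n : polyfun g -> polyfun (fun v => g v ^+ n).
Proof. by move=> [f fE]; exists (f ^+ n) => v; rewrite rmorphXn fE. Qed.

Lemma polyfun_sum (I : Type) (r : seq I) (P : pred I) (g : I -> V -> k) :
  (forall i, polyfun (g i)) -> polyfun (fun v => \sum_(i <- r | P i) g i v).
Proof.
move=> pg; elim: r => [|i r IHr].
  by apply: polyfun_ext (polyfun_cst 0) => v; rewrite big_nil.
case: (boolP (P i)) => Pi; last first.
  by apply: polyfun_ext IHr => v; rewrite big_cons (negPf Pi).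
by apply: polyfun_ext (polyfunD (pg i) IHr) => v; rewrite big_cons Pi.
Qed.

Lemma scalar_pack (l : V -> k) : scalar l -> exists L : {scalar V}, L =1 l.
Proof.
move=> ls; pose lM := GRing.isLinear.Build k V k *%R l ls.
by exists (HB.pack_for {scalar V} l lM).
Qed.

Lemma scalar_coordE (l : V -> k) (v : V) : scalar l ->
  l v = \sum_(i < \dim {:V}) coords v i * l (vbasis {:V})`_i.
Proof.
move=> /scalar_pack[L LE]; rewrite -LE {1}(coord_vbasis (memvf v)) linear_sum.
by apply: eq_bigr => i _; rewrite linearZ LE.
Qed.

Lemma polyfun_scalar (l : V -> k) : scalar l -> polyfun l.
Proof.
move=> ls; exists (\sum_(i < \dim {:V}) l (vbasis {:V})`_i *: 'X_i) => v.
rewrite (scalar_coordE v ls) raddf_sum /=; apply: eq_bigr => i _.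
by rewrite mevalZ mevalXU mulrC.
Qed.

Lemma coords_scalar i : scalar (fun v : V => coords v i).
Proof. by move=> a u v; rewrite /coords linearP. Qed.

Lemma coordsD (u v : V) i : coords (u + v) i = coords u i + coords v i.
Proof. exact: linearD. Qed.

Lemma coordsZ t (v : V) i : coords (t *: v) i = t * coords v i.
Proof. exact: linearZ. Qed.

(** Restricting to lines reduces closure and irreducibility questions to
    polynomials in one variable over an infinite field. *)
Lemma polyfun_line g (u v : V) : polyfun g ->
  exists q : {poly k}, forall t, g (u + t *: v) = q.[t].
Proof.
case=> f fE; exists (mmap (@polyC k) (fun i => (coords u i)%:P + coords v i *: 'X) f).
move=> t; rewrite fE -[RHS]/(horner_eval t _) meval_mmap; last first.
  by move=> c; rewrite /= /horner_eval hornerC.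
by apply: meval_eq => i; rewrite /= /horner_eval !hornerE coordsD coordsZ mulrC.
Qed.

Lemma polyfun_plane g (w u v : V) : polyfun g ->
  exists G : {poly {poly k}}, forall s t, g (w + s *: u + t *: v) = G.[t%:P].[s].
Proof.
case=> f fE; exists (mmap (polyC \o (@polyC k))
  (fun i => (coords w i)%:P%:P + (coords u i *: 'X)%:P + (coords v i)%:P *: 'X) f).
move=> s t; rewrite fE.
rewrite -[RHS]/((horner_eval s \o horner_eval t%:P) _) meval_mmap; last first.
  by move=> c; rewrite /= /horner_eval !hornerC.
apply: meval_eq => i; rewrite /= /horner_eval !hornerE !coordsD !coordsZ.
by rewrite mulrC [t * _]mulrC.
Qed.

Lemma zclosed_polyfun (I : Type) (D : I -> Prop) (g : I -> V -> k) :
  (forall i, polyfun (g i)) -> zclosed [set v | forall i, D i -> g i v = 0].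
Proof.
move=> pg; exists [set f | exists2 i, D i & forall v, g i v = f.@[coords v]].
rewrite predeqE => v; split=> /= [g0 f [i Di <-]|g0 i Di]; first exact: g0.
by have [f fE] := pg i; rewrite fE; apply: g0; exists i.
Qed.

Lemma zclosed_zeros (g : V -> k) : polyfun g -> zclosed [set v | g v = 0].
Proof.
move=> pg; rewrite (_ : [set v | g v = 0] = [set v | forall i : unit, True -> g v = 0]).
  exact: (@zclosed_polyfun unit (fun=> True) (fun=> g)).
by rewrite predeqE => v; split=> [gv _ _|/(_ tt I)].
Qed.

(** Closed sets are used only through this separation property and through
    [zclosureP]; no ideal is ever manipulated. *)
Lemma zclosed_sep (Z : set V) v : zclosed Z -> ~ Z v ->
  exists g, [/\ polyfun g, forall z, Z z -> g z = 0 & g v != 0].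
Proof.
case=> P ->; rewrite /= => nZ; apply: contrapT => H; apply: nZ => f Pf.
apply/eqP; apply: contrapT => /negP fv; apply: H.
exists (fun v => f.@[coords v]); split=> //; first by exists f.
by move=> z /(_ _ Pf).
Qed.

Lemma zclosureP (S : set V) v :
  zclosure S v <-> forall g, polyfun g -> (forall s, S s -> g s = 0) -> g v = 0.
Proof.
split=> [Sv g pg gS|H Z [Zcl SZ]]; last first.
  apply: contrapT => /(zclosed_sep Zcl)[g [pg gZ /eqP]]; apply; apply: H => // s.
  by move=> /SZ/gZ.
by apply: (Sv [set v | g v = 0]); split=> //; exact: zclosed_zeros.
Qed.

Lemma zclosed_closure (S : set V) : zclosed (zclosure S).
Proof.
have -> : zclosure S =
    [set v | forall g : {g | polyfun g},
               (forall s, S s -> sval g s = 0) -> sval g v = 0].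
  rewrite predeqE => v; rewrite zclosureP /=.
  by split=> [H [g pg]|H g pg]; [exact: H | exact: (H (exist _ g pg))].
by apply: zclosed_polyfun => -[].
Qed.

Lemma sub_zclosure (S : set V) : S `<=` zclosure S.
Proof. exact: sub_gen_smallest. Qed.

Lemma zclosure_sub (S Z : set V) : zclosed Z -> S `<=` Z -> zclosure S `<=` Z.
Proof. exact: smallest_sub. Qed.

Lemma zclosed_vspace (W : {vspace V}) : zclosed [set v | v \in W].
Proof.
have -> : [set v | v \in W] =
    [set v | forall i, True -> coords (v - projv W v) i = 0].
  rewrite predeqE => v; split=> /= [vW i _|v0].
    by rewrite projv_id // subrr /coords linear0.
  rewrite -[v](subrK (projv W v)) (_ : v - _ = 0) ?add0r ?memv_proj //.
  rewrite (coord_vbasis (memvf (v - _))) big1 // => i _.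
  by move: (v0 i I); rewrite /coords => ->; rewrite scale0r.
apply: zclosed_polyfun => i; apply: polyfun_scalar => a u v.
rewrite /= -coords_scalar; congr (coords _ i).
by rewrite linearP scalerBr opprD addrACA.
Qed.

Lemma zirreducible_closure (S : set V) : zirreducible S -> zirreducible (zclosure S).
Proof.
case=> [[s Ss] Sirr]; split; first by exists s; exact: sub_zclosure.
move=> A B clA clB SAB.
have [|SA|SB] := Sirr A B clA clB; first exact: subset_trans (@sub_zclosure S) SAB.
- by left; exact: zclosure_sub.
- by right; exact: zclosure_sub.
Qed.

End PolynomialFunctions.

(** * Images of affine spaces *)

Section PolynomialMaps.
Variables (k : closedFieldType) (V : vectType k).

(** Testing against all linear functionals, and not against coordinates, makes
    the notion compatible with products, for which no explicit basis is needed. *)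
Definition polymap n (phi : ('I_n -> k) -> V) : Prop :=
  forall l : V -> k, scalar l ->
    exists q : {mpoly k[n]}, forall v, l (phi v) = q.@[v].

Lemma polymap_polyfun n (phi : ('I_n -> k) -> V) (g : V -> k) :
  polymap phi -> polyfun g ->
  exists q : {mpoly k[n]}, forall v, g (phi v) = q.@[v].
Proof.
move=> pphi [f fE].
have /choice[q qE] : forall i, exists q : {mpoly k[n]},
    forall v, coords (phi v) i = q.@[v].
  by move=> i; apply: pphi; exact: coords_scalar.
exists (mmap (@mpolyC n k) q f) => v; rewrite fE meval_mmap.
  by apply: meval_eq => i; rewrite /= qE.
by move=> c; rewrite /= mevalC.
Qed.

Lemma polymap_sum n (I : finType) (q : I -> {mpoly k[n]}) (e : I -> V)
    (phi : ('I_n -> k) -> V) :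
  (forall v, phi v = \sum_i (q i).@[v] *: e i) -> polymap phi.
Proof.
move=> phiE l ls; exists (\sum_i l (e i) *: q i) => v.
have [L LE] := scalar_pack ls.
rewrite phiE -LE linear_sum raddf_sum /=; apply: eq_bigr => i _.
by rewrite linearZ mevalZ mulrC LE.
Qed.

(** Were the image covered by two closed sets neither of which contains it, there
    would be parameters [u] and [w] where equations [f] and [g] of the two sets
    do not vanish; on the line through [u] and [w] the product [f g] is the zero
    polynomial, although neither factor is. *)
Lemma zirreducible_image n (phi : ('I_n -> k) -> V) :
  polymap phi -> zirreducible (range phi).
Proof.
move=> pphi; split; first by exists (phi (fun=> 0)); exists (fun=> 0).
move=> A B clA clB sAB; apply: contrapT => /not_orP[nA nB].
have sep C : zclosed C -> ~ range phi `<=` C -> exists u (q : {mpoly k[n]}),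
    q.@[u] != 0 /\ forall v, C (phi v) -> q.@[v] = 0.
  move=> clC nC; have [u nCu] : exists u, ~ C (phi u).
    apply: contrapT => /forallNP H; apply: nC => _ [u _ <-].
    exact: contrapT (H u).
  have [g [pg gC gu]] := zclosed_sep clC nCu.
  have [q qE] := polymap_polyfun pphi pg.
  by exists u, q; rewrite -qE; split=> // v /gC; rewrite qE.
have [u [f [fu fA]]] := sep _ clA nA.
have [w [g [gw gB]]] := sep _ clB nB.
pose a i : {poly k} := (u i)%:P + (w i - u i) *: 'X.
have ev (q : {mpoly k[n]}) t :
    (mmap (@polyC k) a q).[t] = q.@[fun i => u i + (w i - u i) * t].
  rewrite -[LHS]/(horner_eval t _) meval_mmap.
    by apply: meval_eq => i; rewrite /a /= /horner_eval !hornerE.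
  by move=> c; rewrite /= /horner_eval hornerC.
have : mmap (@polyC k) a f * mmap (@polyC k) a g = 0.
  apply: horner_eq0 => t; rewrite hornerM !ev.
  have [/fA ->|/gB ->] : (A `|` B) (phi (fun i => u i + (w i - u i) * t)).
  - by apply: sAB; exists (fun i => u i + (w i - u i) * t).
  - by rewrite mul0r.
  - by rewrite mulr0.
move/eqP; rewrite mulf_eq0 => /orP[] /eqP H.
- move: (ev f 0); rewrite H horner0 => /esym/eqP; apply/negP.
  by rewrite (meval_eq (v2 := u)) // => i; rewrite mulr0 addr0.
- move: (ev g 1); rewrite H horner0 => /esym/eqP; apply/negP.
  by rewrite (meval_eq (v2 := w)) // => i; rewrite mulr1 addrC subrK.
Qed.

Lemma polyfun_meval n (Q : {mpoly k[n]}) (f : 'I_n -> V -> k) :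
  (forall i, polyfun (f i)) -> polyfun (fun v => Q.@[fun i => f i v]).
Proof.
move=> /choice[F FE]; exists (mmap (@mpolyC _ k) F Q) => v.
rewrite meval_mmap; first by apply: meval_eq => i; rewrite /= FE.
by move=> c; rewrite /= mevalC.
Qed.

Lemma zirreducible_mul (Y : set V) (g h : V -> k) : zirreducible Y ->
  polyfun g -> polyfun h -> (forall v, Y v -> g v * h v = 0) ->
  (exists2 v, Y v & g v != 0) -> forall v, Y v -> h v = 0.
Proof.
move=> [_ Yirr] pg ph gh [w Yw gw].
have [|Yg|Yh] := Yirr _ _ (zclosed_zeros pg) (zclosed_zeros ph).
- move=> v Yv; have /eqP := gh v Yv; rewrite mulf_eq0.
  by move=> /orP[] /eqP ?; [left|right].
- by have := Yg _ Yw; move/eqP: gw.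
- exact: Yh.
Qed.

(** [muni] singles out the last variable; this is how the chain argument below
    removes one variable per member of the chain. *)
Lemma meval_muni n (Q : {mpoly k[n.+1]}) (f : nat -> k) :
  Q.@[fun i => f i] = (map_poly (meval (fun i : 'I_n => f i)) (muni Q)).[f n].
Proof.
rewrite muniE rmorph_sum horner_sum mevalE; apply: eq_bigr => m _.
rewrite -mul_polyC rmorphM /= map_polyC map_polyXn hornerM hornerC hornerXn /=.
rewrite mevalZ mevalX -mulrA; congr (_ * _).
rewrite big_ord_recr /=; congr (_ * _).
by apply: eq_bigr => i _; rewrite mnmE.
Qed.

Lemma muni_neq0 n (Q : {mpoly k[n.+1]}) : Q != 0 -> muni Q != 0.
Proof.
apply: contra_neq => Q0; apply/mpolyP => m; rewrite mcoeff0.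
have := congr1 (fun P : {poly {mpoly k[n]}} =>
  (P`_(m ord_max))@_[multinom (m (widen_ord (leqnSn n) i)) | i < n]) Q0.
rewrite coef0 mcoeff0 muniE coef_sum raddf_sum /= => <-.
have -> : Q@_m = \sum_(m' <- msupp Q) Q@_m' * (m' == m)%:R.
  by rewrite {1}[Q]mpolyE raddf_sum /=; apply: eq_bigr => i _; rewrite mcoeffZ mcoeffX.
apply: eq_bigr => m' _; rewrite coefZ coefXn.
have [->|nm] := eqVneq m' m.
  by rewrite eqxx mulr1 mulr1 mcoeffZ mcoeffX eqxx mulr1.
case: eqP => [em|]; rewrite ?mulr1 ?mulr0 ?mcoeff0 //.
rewrite mcoeffZ mcoeffX; case: eqP => [/mnmP e|]; rewrite ?mulr0 //.
case/eqP: nm; apply/mnmP => i; have [ilt|] := ltnP i n.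
  have := e (Ordinal ilt); rewrite !mnmE.
  by rewrite (_ : widen_ord _ _ = i); [move=> -> | apply: val_inj].
move=> ni; rewrite (_ : i = ord_max) //.
by apply/val_inj/eqP; rewrite eqn_leq ni -ltnS ltn_ord.
Qed.

(** A strict chain of irreducible sets, with [f i] vanishing on [Y i] but not on
    [Y i.+1], produces algebraically independent functions.  A relation on
    [Y n.+1] can be divided by the largest power of its last variable, because
    [Y n.+1] is irreducible and [f n] is not zero on it; restricting the
    quotient to [Y n], where [f n] vanishes, leaves a nontrivial relation in one
    variable less. *)
Lemma chain_independent n (Y : nat -> set V) (f : nat -> V -> k) :
  (forall i, (i <= n)%N -> zirreducible (Y i)) ->
  (forall i, (i < n)%N -> Y i `<=` Y i.+1) ->
  (forall i, (i < n)%N -> [/\ polyfun (f i), forall v, Y i v -> f i v = 0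
                          & exists2 v, Y i.+1 v & f i v != 0]) ->
  forall Q : {mpoly k[n]}, Q != 0 ->
    ~ (forall v, Y n v -> Q.@[fun i => f i v] = 0).
Proof.
elim: n => [|n IHn] Yirr Yinc fY Q Q0 QY.
  have [[v Yv] _] := Yirr 0 (leqnn _).
  move: Q0 (QY v Yv); rewrite [Q]nvar0_mpolyC mevalC => /eqP c0 cE.
  by apply: c0; rewrite cE mpolyC0.
have [m [P]] := multiplicity_XsubC (muni Q) 0.
rewrite muni_neq0 //= rootE horner_coef0 subr0 => P0 PE.
have [pfn fn0 fn1] := fY n (leqnn _).
pose ev (P : {poly {mpoly k[n]}}) v :=
  (map_poly (meval (fun i : 'I_n => f i v)) P).[f n v].
have pev : polyfun (ev P).
  have evE v : \sum_(i < size P) (P`_i).@[fun i : 'I_n => f i v] * f n v ^+ i = ev P v.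
    rewrite /ev -[in RHS](coefK P) poly_def rmorph_sum horner_sum.
    by apply: eq_bigr => i _; rewrite /= map_polyZ map_polyXn hornerZ hornerXn.
  apply: (polyfun_ext evE).
  apply: polyfun_sum => i; apply: polyfunM; last exact: polyfunX.
  by apply: polyfun_meval => j; have [] := fY j (ltnW (ltn_ord j)).
have evY v : Y n.+1 v -> ev P v = 0.
  apply: (zirreducible_mul (Yirr _ (leqnn _)) (polyfunX m pfn) pev) v.
    move=> v /QY; rewrite (meval_muni Q (f^~ v)) PE rmorphM rmorphXn /= map_polyX.
    by rewrite hornerM hornerXn mulrC.
  by have [v Yv fv] := fn1; exists v => //; rewrite expf_neq0.
apply: (IHn _ _ _ P`_0 P0).
- by move=> i /leqW; exact: Yirr.
- by move=> i /leqW; exact: Yinc.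
- by move=> i /leqW; exact: fY.
move=> v Yv; have := evY v (Yinc _ (leqnn _) v Yv).
by rewrite /ev fn0 // horner_coef0 coef_map.
Qed.

End PolynomialMaps.

(** * Dimension *)

Lemma msize_mul (k : fieldType) n (p q : {mpoly k[n]}) a b :
  (msize p <= a.+1)%N -> (msize q <= b.+1)%N -> (msize (p * q) <= (a + b).+1)%N.
Proof.
move=> pa qb; have [->|p0] := eqVneq p 0; first by rewrite mul0r msize0.
have [->|q0] := eqVneq q 0; first by rewrite mulr0 msize0.
rewrite msizeM //; have := leq_add pa qb; rewrite addSn addnS.
by case: (_ + _)%N.
Qed.

Lemma rV_kernel (k : fieldType) m n (A : 'M[k]_(m, n)) :
  (n < m)%N -> exists2 c : 'rV[k]_m, c != 0 & c *m A = 0.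
Proof.
move=> nm; have /rowV0Pn[c /sub_kermxP cA c0] : kermx A != 0.
  rewrite kermx_eq0; apply: contraL nm => /eqP rA.
  by rewrite -leqNgt -rA rank_leq_col.
by exists c.
Qed.

(** Dimension count: the monomials in the [q i] with all exponents less than [M]
    number [M ^ d.+1], while they live in a space of polynomials whose dimension
    is at most a constant times [M ^ d]. *)
Lemma algebraic_dependence (k : fieldType) d (q : 'I_d.+1 -> {mpoly k[d]}) :
  exists2 Q : {mpoly k[d.+1]}, Q != 0
    & forall v, Q.@[fun i => (q i).@[v]] = 0.
Proof.
pose D := \max_i msize (q i).
(* [B] bounds the degrees of the monomials; [K] is chosen with [B <= M * K], so
   that [M = K ^ d + 1] gives [B ^ d < M ^ d.+1]. *)
pose K := (d.+1 * D).+1; pose M := (K ^ d).+1; pose B := (d.+1 * (M * D)).+1.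
pose E : finType := {ffun 'I_d.+1 -> 'I_M}.
pose F : finType := {ffun 'I_d -> 'I_B}.
have BMK : (B <= M * K)%N.
  by rewrite /B /K mulnS mulnCA -[in X in (X <= _)%N]add1n leq_add2r.
have FE : (#|F| < #|E|)%N.
  rewrite !card_ffun !card_ord; have expl a b : (a <= b)%N -> (a ^ d <= b ^ d)%N.
    by case: (d) => // d' ab; rewrite leq_exp2r.
  apply: leq_ltn_trans (expl _ _ BMK) _.
  by rewrite expnMn expnSr ltn_pmul2l // expn_gt0.
pose w (e : E) := \prod_i q i ^+ e i.
have szw e : (msize (w e) <= B)%N.
  rewrite /w /B -[d.+1 in X in (_ <= X)%N]card_ord -sum_nat_const.
  elim/big_rec2: _ => [|i s r _ sr]; first by rewrite msize1.
  apply: msize_mul sr; apply: (@leq_trans (e i * D).+1); last first.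
    by rewrite ltnS leq_mul2r (ltnW (ltn_ord _)) orbT.
  elim: (nat_of_ord (e i)) => [|m IHm]; first by rewrite expr0 msize1.
  rewrite exprS mulSn; apply: msize_mul IHm; apply: leqW.
  exact: (leq_bigmax i).
pose A : 'M[k]_(#|E|, #|F|) :=
  \matrix_(e, b) (w (enum_val e))@_[multinom (enum_val b : F) i : nat | i < d].
have [c c0 cA] := rV_kernel A FE.
pose x (e : E) := [multinom e i : nat | i < d.+1].
have x_inj : injective x.
  move=> e e' /mnmP ee; apply/ffunP => i; apply: val_inj.
  by have := ee i; rewrite !mnmE.
exists (\sum_(e : E) c 0 (enum_rank e) *: 'X_[x e]).
  apply: contra_neq c0 => Q0; apply/rowP => j; rewrite mxE.
  have := congr1 (mcoeff (x (enum_val j))) Q0; rewrite raddf_sum mcoeff0 /= => <-.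
  rewrite (bigD1 (enum_val j)) //= mcoeffZ mcoeffX eqxx mulr1 enum_valK.
  rewrite big1 ?addr0 // => e ne; rewrite mcoeffZ mcoeffX (inj_eq x_inj).
  by rewrite (negPf ne) mulr0.
move=> v; have W0 : \sum_(e : E) c 0 (enum_rank e) *: w e = 0.
  apply/mpolyP => m; rewrite mcoeff0 raddf_sum /=.
  case: (boolP [forall i, m i < B]%N) => [/forallP mB|].
    pose b : F := [ffun i => Ordinal (mB i)].
    have := congr1 (fun u : 'rV_ _ => u 0 (enum_rank b)) cA.
    rewrite !mxE => cA0; rewrite -[RHS]cA0 (reindex (@enum_rank E)) /=; last first.
      by exists enum_val => z _; rewrite ?enum_rankK ?enum_valK.
    apply: eq_bigr => e _; rewrite mcoeffZ !mxE !enum_rankK; congr (_ * _@__).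
    by apply/mnmP => i; rewrite mnmE ffunE.
  rewrite negb_forall => /existsP[i]; rewrite -leqNgt => Bi.
  rewrite big1 // => e _; rewrite mcoeffZ [X in _ * X]memN_msupp_eq0 ?mulr0 //.
  apply: msize_mdeg_ge; apply: leq_trans (szw e) (leq_trans Bi _).
  by rewrite mdegE (bigD1 i) //= leq_addr.
rewrite -[RHS](meval0 v) -W0 !raddf_sum /=; apply: eq_bigr => e _.
rewrite !mevalZ mevalX /w rmorph_prod; congr (_ * _); apply: eq_bigr => i _.
by rewrite mnmE rmorphXn.
Qed.

Section Dimension.
Variables (k : closedFieldType) (V : vectType k).

Lemma irr_chain_image n (phi : ('I_n -> k) -> V) m :
  polymap phi -> irr_chain (zclosure (range phi)) m -> (m <= n)%N.
Proof.
move=> pphi [Y [Yp Yinc]]; rewrite leqNgt; apply/negP => nm.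
have /choice[f fP] : forall i, exists f : V -> k, (i < m)%N ->
    [/\ polyfun f, forall v, Y i v -> f v = 0 & exists2 v, Y i.+1 v & f v != 0].
  move=> i; case: (ltnP i m) => [im|]; last by exists (fun=> 0).
  have [clY _ _] := Yp i (ltnW im); have [_ /nonsubset[v [Yv nYv]]] := Yinc i im.
  have [g [pg gY gv]] := zclosed_sep clY nYv.
  by exists g => _; split=> //; exists v.
have /choice[q qE] : forall i : 'I_n.+1, exists q : {mpoly k[n]},
    forall v, f i (phi v) = q.@[v].
  move=> i; have [|pf _ _] := fP i; first exact: leq_trans (ltn_ord i) nm.
  exact: polymap_polyfun pphi pf.
have [Q Q0 QE] := algebraic_dependence q.
apply: (@chain_independent k V n.+1 Y f _ _ _ Q Q0) => [i im|i im|i im|].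
- by have [] := Yp i (leq_trans im nm).
- by have [] := Yinc i (leq_trans im nm).
- by apply: fP; exact: leq_trans im nm.
have [_ _ Ysub] := Yp n.+1 nm.
suff sQ : zclosure (range phi) `<=` [set v | Q.@[fun i : 'I_n.+1 => f i v] = 0].
  by move=> v /Ysub/sQ.
apply: zclosure_sub.
  apply: zclosed_zeros.
  apply: (@polyfun_meval k V n.+1 Q (fun i : 'I_n.+1 => f i)) => i.
  by have [] := fP i (leq_trans (ltn_ord i) nm).
by move=> _ [v _ <-]; rewrite /= -(QE v); apply: meval_eq => i.
Qed.

(** Lower bounds for dimensions are obtained by putting a closed irreducible set
    strictly above a chain, starting from a flag of linear subspaces. *)
Lemma irr_chainS (Z Z' : set V) n : zclosed Z' -> zirreducible Z' ->
  Z `<=` Z' -> ~ (Z' `<=` Z) -> irr_chain Z n -> irr_chain Z' n.+1.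
Proof.
move=> clZ irrZ sZZ nZZ [Y [Yp Yinc]].
exists (fun i => if (i <= n)%N then Y i else Z'); split=> i ii.
  case: (leqP i n) => [/Yp[? ? YZ]|_]; last by split.
  by split=> //; exact: subset_trans sZZ.
have /orP[/eqP->|i_n] : (i == n) || (i < n)%N by rewrite -leq_eqVlt -ltnS.
  2: by rewrite /= i_n (ltnW i_n); exact: Yinc.
rewrite /= leqnn ltnn; have [_ _ YZ] := Yp n (leqnn _).
split; first exact: subset_trans sZZ.
by move=> Z'Y; apply: nZZ; exact: subset_trans YZ.
Qed.

Lemma zirreducible_vspace (W : {vspace V}) : zirreducible [set v | v \in W].
Proof.
pose phi (a : 'I_(\dim W) -> k) := \sum_i a i *: (vbasis W)`_i.
have -> : [set v | v \in W] = range phi.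
  rewrite predeqE => v; split=> [vW|[a _ <-]].
    by exists (fun i => coord (vbasis W) i v) => //; rewrite /phi -coord_vbasis.
  by apply: memv_suml => i _; apply/memvZ/vbasis_mem/mem_nth; rewrite size_tuple.
apply: zirreducible_image; apply: (@polymap_sum _ _ _ _ (fun i => 'X_i)) => a.
by apply: eq_bigr => i _; rewrite mevalXU.
Qed.

(** The functionals [l] form, up to triangularity, a dual family of the vectors
    [e]; they make the inclusions in the flag spanned by the [e i] strict. *)
Lemma irr_chain_vspace (Z : set V) d (e : nat -> V) (l : nat -> V -> k) :
  (forall i, scalar (l i)) ->
  (forall i j, (i < d)%N -> (j < i)%N -> l i (e j) = 0) ->
  (forall i, (i < d)%N -> l i (e i) != 0) ->
  Z 0 -> (forall a u v, Z u -> Z v -> Z (a *: u + v)) ->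
  (forall i, (i < d)%N -> Z (e i)) -> irr_chain Z d.
Proof.
move=> ls l0 l1 Z0 ZD Ze.
exists (fun i => [set v | v \in <<mkseq e i>>%VS]); split=> i ii.
  split; [exact: zclosed_vspace | exact: zirreducible_vspace |].
  move=> v /= /coord_span ->; elim/big_rec: _ => // j u _ Zu; apply: ZD => //.
  rewrite [_`_j](nth_mkseq 0 e (ltn_ord j)); apply: Ze.
  exact: leq_trans (ltn_ord j) ii.
split.
  move=> v /=; apply: (subvP (sub_span _)).
  by move=> _ /mapP[j + ->]; rewrite mem_iota => /andP[_ ji];
    apply: map_f; rewrite mem_iota (leq_trans ji) // leqW.
move=> /(_ (e i)) /=; have -> : e i \in <<mkseq e i.+1>>%VS.
  by apply/memv_span/map_f; rewrite mem_iota /= add0n ltnSn.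
move=> /(_ isT); have [L LE] := scalar_pack (ls i) => /coord_span ei.
case/eqP: (l1 i ii); rewrite -LE ei linear_sum big1 // => j _.
have ji : (j < i)%N := ltn_ord j.
by rewrite linearZ LE [_`_j](nth_mkseq 0 e ji) l0 //= mulr0.
Qed.

End Dimension.

(** * Irreducible components of a finite union *)

Section Components.
Variables (k : closedFieldType) (V : vectType k).

Lemma zclosedU (A B : set V) : zclosed A -> zclosed B -> zclosed (A `|` B).
Proof.
move=> clA clB; rewrite (_ : _ `|` _ = zclosure (A `|` B)).
  exact: zclosed_closure.
apply/seteqP; split; first exact: sub_zclosure.
move=> v vAB; apply: contrapT => /not_orP[nA nB].
have [f [pf fA fv]] := zclosed_sep clA nA.
have [g [pg gB gv]] := zclosed_sep clB nB.
have /eqP : f v * g v = 0.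
  apply: (zclosureP _ v).1 vAB _ (polyfunM pf pg) _ => s.
  by case=> [/fA ->|/gB ->]; rewrite ?mul0r ?mulr0.
by rewrite mulf_eq0 (negPf fv) (negPf gv).
Qed.

Definition union_upto (Z : nat -> set V) n : set V :=
  \bigcup_(i in [set i : nat | (i <= n)%N]) Z i.

Lemma union_uptoS (Z : nat -> set V) n : union_upto Z n.+1 = union_upto Z n `|` Z n.+1.
Proof.
apply/seteqP; split=> [v [i /=]|v [[i /= i_n Zi]|Zv]].
- by rewrite leq_eqVlt => /orP[/eqP->|i_n Zi]; [right|left; exists i].
- by exists i => //=; exact: leqW.
- by exists n.+1 => /=.
Qed.

Lemma zclosed_union_upto (Z : nat -> set V) n :
  (forall i, zclosed (Z i)) -> zclosed (union_upto Z n).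
Proof.
move=> clZ; elim: n => [|n IHn]; last by rewrite union_uptoS; exact: zclosedU.
rewrite (_ : union_upto Z 0 = Z 0%N) //; apply/seteqP; split=> [v [i /=]|v Zv].
  by rewrite leqn0 => /eqP->.
by exists 0%N.
Qed.

Lemma zirreducible_union_upto (Z : nat -> set V) n (Y : set V) :
  zirreducible Y -> (forall i, zclosed (Z i)) -> Y `<=` union_upto Z n ->
  exists2 i, (i <= n)%N & Y `<=` Z i.
Proof.
move=> Yirr clZ; elim: n => [|n IHn] sY.
  by exists 0%N => // v /sY[i /=]; rewrite leqn0 => /eqP ->.
have [|sYn|] := Yirr.2 _ _ (zclosed_union_upto n clZ) (clZ n.+1).
- by rewrite -union_uptoS.
- by have [i i_n sYi] := IHn sYn; exists i => //; exact: leqW.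
- by exists n.+1.
Qed.

Lemma irr_component_union_upto (Z : nat -> set V) n (Y : set V) :
  (forall i, zclosed (Z i)) -> (forall i, (i <= n)%N -> zirreducible (Z i)) ->
  (forall i j, (i <= n)%N -> (j <= n)%N -> Z i `<=` Z j -> i = j) ->
  irr_component (union_upto Z n) Y <-> exists i, (i <= n)%N /\ Y = Z i.
Proof.
move=> clZ irrZ Zinc; split=> [[sY irrY maxY]|[i [i_n ->]]].
  have [i i_n sYi] := zirreducible_union_upto irrY clZ sY.
  exists i; split=> //; apply/esym/maxY => //; first exact: irrZ.
  by move=> v Zv; exists i.
split; [by move=> v Zv; exists i | exact: irrZ |].
move=> Y' irrY' sZY sY'.
have [j j_n sYj] := zirreducible_union_upto irrY' clZ sY'.
have ij : i = j by apply: Zinc => //; exact: subset_trans sYj.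
by apply/seteqP; split=> //; rewrite ij.
Qed.

(** The limit process applied to commuting pairs: if the line through [u]
    directed by [v] lies in [Z] except at finitely many points, the exceptional
    points lie in [Z] as well. *)
Lemma zclosed_line (Z : set V) u v (r : {poly k}) : zclosed Z -> r != 0 ->
  (forall t, r.[t] != 0 -> Z (u + t *: v)) -> Z u.
Proof.
move=> clZ r0 Zt; apply: contrapT => /(zclosed_sep clZ)[g [pg gZ /eqP]]; apply.
have [q qE] := polyfun_line u v pg.
have q0 : q = 0 by apply: horner_ae_eq0 r0 _ => t /Zt/gZ; rewrite qE.
by have := qE 0; rewrite q0 horner0 scale0r addr0.
Qed.

(** The polynomials [h] and [F] are in a variable [t] over [k[s]].  For [s <> 0]
    every root of [h] is a root of [F], so [h] divides [F ^+ n] where [n] is the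
    degree of [h] in [t].  As [h] is monic, the remainder of [F ^+ n] by [h]
    commutes with specialization of [s]; being zero for all [s <> 0], it is
    zero, and the divisibility persists at [s = 0]. *)
Lemma root_specialization (h F : {poly {poly k}}) : h \is monic ->
  (forall s t, s != 0 -> h.[t%:P].[s] = 0 -> F.[t%:P].[s] = 0) ->
  forall t, h.[t%:P].[0] = 0 -> F.[t%:P].[0] = 0.
Proof.
move=> hm hF t ht.
pose ev s (G : {poly {poly k}}) : {poly k} := map_poly (horner_eval s) G.
have evE s G x : (ev s G).[x] = G.[x%:P].[s].
  rewrite -[RHS]/(horner_eval s _) -horner_map /= /horner_eval hornerC //.
pose n := (size h).-1; pose r := Pdiv.Ring.rmodp (F ^+ n) h.
have FE : F ^+ n = Pdiv.Ring.rdivp (F ^+ n) h * h + r.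
  exact: Pdiv.RingMonic.rdivp_eq.
have evh s : ev s h \is monic by exact: monic_map.
have szh s : size (ev s h) = size h.
  by rewrite size_map_poly_id0 // (monicP hm) /horner_eval hornerC oner_eq0.
have dvd s : s != 0 -> ev s h %| ev s F ^+ n.
  move=> s0; have [rs hE] := closed_field_poly_normal (ev s h).
  rewrite hE (monicP (evh s)) scale1r.
  have -> : n = size rs.
    by rewrite /n -(szh s) hE (monicP (evh s)) scale1r size_prod_XsubC.
  have : forall x, x \in rs -> (ev s F).[x] = 0.
    move=> x xrs; rewrite evE; apply: hF => //; rewrite -evE hE.
    by apply/eqP; rewrite hornerZ (rootP _) ?mulr0 // root_prod_XsubC.
  elim: rs {hE} => [|x rs IHrs] rF; first by rewrite big_nil dvd1p.
  rewrite big_cons exprS dvdp_mul //.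
    by rewrite dvdp_XsubCl; apply/rootP/rF; exact: mem_head.
  by apply: IHrs => y yrs; apply: rF; rewrite inE yrs orbT.
have szr s : (size (ev s r) < size (ev s h))%N.
  rewrite szh (leq_ltn_trans (size_poly _ _)) //.
  by rewrite Pdiv.Ring.ltn_rmodpN0 // monic_neq0.
have r0 : r = 0.
  apply/polyP => i; rewrite coef0; apply: (@horner_ae_eq0 k _ 'X) => [|s].
    by rewrite polyX_eq0.
  rewrite hornerX => s0; have : ev s h %| ev s r.
    rewrite -(dvdp_addr (m := ev s (Pdiv.Ring.rdivp (F ^+ n) h * h))).
      by rewrite -rmorphD /= -FE rmorphXn dvd.
    by rewrite [ev s (_ * _)]rmorphM dvdp_mull.
  have [rs0 _|rs0 /(dvdp_leq rs0)] := eqVneq (ev s r) 0; last by rewrite leqNgt szr.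
  by have /(congr1 (fun q : {poly k} => q`_i)) := rs0; rewrite coef_map coef0.
have /eqP : (F ^+ n).[t%:P].[0] = 0 by rewrite FE r0 addr0 !hornerM ht mulr0.
by rewrite !horner_exp expf_eq0 => /andP[_ /eqP].
Qed.

End Components.

(** * Truncated polynomials in characteristic p *)

Section TruncatedPolynomials.
Variables (k : fieldType) (p : nat).
Hypothesis pk : p \in [pchar k].
Local Notation A := (trunc_poly k p).

Let p_pr : prime p := pcharf_prime pk.
Let p_gt0 : (0 < p)%N := prime_gt0 p_pr.

Lemma coef_in_qpoly (q : {poly k}) m : (m < p)%N -> (in_qpoly 'X^p q : A)`_m = q`_m.
Proof.
move=> mp; rewrite /= mk_monic_Xp //.
rewrite [in RHS](Pdiv.RingMonic.rdivp_eq (monicXn k p) q).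
by rewrite coefD coefMXn mp add0r.
Qed.

Lemma size_trunc (a : A) : (size (a : {poly k}) <= p)%N.
Proof.
by rewrite -ltnS (leq_trans (size_mk_monic a)) // mk_monic_Xp // size_polyXn.
Qed.

Lemma trunc_inj (a b : A) : (forall m, (m < p)%N -> a`_m = b`_m) -> a = b.
Proof.
move=> ab; apply/val_inj/polyP => m /=; have [/ab //|pm] := ltnP m p.
by rewrite !nth_default // (leq_trans (size_trunc _)).
Qed.

Lemma coef_truncM (a b : A) m : (m < p)%N ->
  (a * b)`_m = ((a : {poly k}) * (b : {poly k}))`_m.
Proof. by move=> mp; rewrite -coef_in_qpoly // poly_of_qpolyM. Qed.

Lemma coef_trunc1 m : (m < p)%N -> (1 : A)`_m = (m == 0%N)%:R.
Proof. by move=> mp; rewrite -in_qpoly1 coef_in_qpoly // coef1. Qed.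

Lemma coef_dX (a : A) m : (m < p)%N -> (dX_fun a)`_m = a`_m.+1 *+ m.+1.
Proof. by move=> mp; rewrite coef_in_qpoly // coef_deriv. Qed.

Lemma qX_trunc : 'qX ^+ p = 0 :> A.
Proof.
apply: trunc_inj => m mp.
by rewrite -in_qpolyXn coef_in_qpoly // coefXn coef0 (ltn_eqF mp).
Qed.

(** Together with [qX_trunc], this makes the Frobenius power of a truncated
    polynomial constant. *)
Lemma trunc_const_add (a : A) : exists b : A, a = (a`_0)%:A + 'qX * b.
Proof.
exists (in_qpoly 'X^p (drop_poly 1 (a : {poly k}))).
have {1}-> : a = in_qpoly 'X^p (a : {poly k}).
  by apply/val_inj/esym/in_qpoly_small/size_mk_monic.
rewrite -[X in in_qpoly _ X](poly_take_drop 1) in_qpolyD in_qpolyM expr1 mulrC.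
congr (_ + _); rewrite -in_qpoly1 -in_qpolyZ; congr in_qpoly.
by apply/polyP => -[|i]; rewrite coef_take_poly coefZ coef1 /= ?mulr1 ?mulr0.
Qed.

Lemma trunc_Frobenius (a : A) : a ^+ p = (a`_0 ^+ p)%:A.
Proof.
have [b aE] := trunc_const_add a.
have pA : p \in [pchar A] by rewrite pchar_lalg.
rewrite [in LHS]aE exprDn_pchar ?pnatE // exprMn qX_trunc mul0r addr0.
by rewrite exprZn expr1n.
Qed.

End TruncatedPolynomials.

(** * Coefficients of elements of the Witt algebra *)

Section WittAlgebra.
Variables (k : closedFieldType) (p : nat).
Hypothesis pk : p \in [pchar k].
Local Notation A := (trunc_poly k p).
Local Notation W := (witt k p).

(** The truncated polynomial [f] such that [x] is the derivation [f D], see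
    [symb_act]. *)
Definition symb (x : W) : A := vsval x 'qX.
Definition witt_of_coefs (c : nat -> k) : W := \sum_(i < p) c i *: witt_XD k p i.
Definition of_symb (f : A) : W := witt_of_coefs (nth 0 (f : {poly k})).
Definition coefW (m : nat) (x : W) : k := (symb x)`_m.

Lemma symb_linear : linear symb.
Proof. by move=> c x y; rewrite /symb linearP add_lfunE scale_lfunE. Qed.

HB.instance Definition _ := GRing.isLinear.Build k W A _ symb symb_linear.

Lemma coefW_scalar m : scalar (coefW m).
Proof. by move=> c x y; rewrite /coefW linearP coefD coefZ. Qed.

Lemma coefWD m x y : coefW m (x + y) = coefW m x + coefW m y.
Proof. by rewrite /coefW linearD coefD. Qed.

Lemma coefWZ m c x : coefW m (c *: x) = c * coefW m x.
Proof. by rewrite /coefW linearZ coefZ. Qed.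

Lemma coefWB m x y : coefW m (x - y) = coefW m x - coefW m y.
Proof. by rewrite /coefW linearB coefB. Qed.

Lemma coefW_XD m n : (n < p)%N -> coefW m (witt_XD k p n) = (m == n)%:R.
Proof.
move=> np; rewrite /coefW /symb witt_XD_X // -in_qpolyXn.
have [mp|pm] := ltnP m p; first by rewrite coef_in_qpoly // coefXn.
by rewrite nth_default ?(leq_trans (size_trunc pk _)) // gtn_eqF // (leq_trans np).
Qed.

Lemma symb_inj : injective symb.
Proof. by move=> x y xy; apply/val_inj/derivation_ext; rewrite ?subvsP. Qed.

Lemma coefW_inj x y : (forall m, (m < p)%N -> coefW m x = coefW m y) -> x = y.
Proof. by move=> xy; apply/symb_inj/(trunc_inj pk). Qed.

Lemma coef_witt_of_coefs c m : (m < p)%N -> coefW m (witt_of_coefs c) = c m.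
Proof.
move=> mp; rewrite /witt_of_coefs /coefW linear_sum coefn_sum (bigD1 (Ordinal mp)) //=.
rewrite linearZ coefZ -/(coefW _ _) coefW_XD // eqxx mulr1 big1 ?addr0 // => i ne.
rewrite linearZ coefZ -/(coefW _ _) coefW_XD // -val_eqE in ne *.
by rewrite eq_sym (negPf ne) mulr0.
Qed.

Lemma of_symbK f : symb (of_symb f) = f.
Proof. by apply: (trunc_inj pk) => m mp; exact: coef_witt_of_coefs. Qed.

Lemma symbK x : of_symb (symb x) = x.
Proof. by apply: symb_inj; rewrite of_symbK. Qed.

Lemma symb_act (x : W) (a : A) : vsval x a = symb x * dX_fun a.
Proof.
rewrite -[in LHS](symbK x) /of_symb /witt_of_coefs linear_sum sum_lfunE /=.
rewrite -{2}(symbK x) /of_symb /witt_of_coefs /symb linear_sum sum_lfunE mulr_suml.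
apply: eq_bigr => i _; rewrite linearZ !scale_lfunE witt_XD_X // -scalerAl.
by rewrite val_witt_XD // lfunE.
Qed.

Lemma symb_bracket (x y : W) :
  symb (lie_br x y) = symb x * dX_fun (symb y) - symb y * dX_fun (symb x).
Proof.
rewrite {1}/symb val_lie_br add_lfunE opp_lfunE !comp_lfunE.
by rewrite (symb_act x (symb y)) (symb_act y (symb x)).
Qed.

Lemma bracket0P (x y : W) :
  lie_br x y = 0 <-> symb x * dX_fun (symb y) = symb y * dX_fun (symb x).
Proof.
split=> [xy0|/eqP xy]; last first.
  apply: symb_inj; apply/eqP.
  by rewrite linear0 symb_bracket subr_eq0.
by apply/eqP; rewrite -subr_eq0 -symb_bracket xy0 linear0.
Qed.

Lemma pmap_act (x : W) (a : A) : vsval (Defs.pmap x) a = iter p (vsval x : A -> A) a.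
Proof.
rewrite val_pmap //.
have itE n : iter n (comp_lfun (vsval x)) \1%VF a = iter n (vsval x : A -> A) a.
  by elim: n => [|n IHn] /=; rewrite ?id_lfunE // comp_lfunE IHn.
exact: itE.
Qed.

End WittAlgebra.

(** * Nilpotent elements and centralizers *)

Section Nilpotency.
Variables (k : closedFieldType) (p : nat).
Hypothesis pk : p \in [pchar k].
Local Notation A := (trunc_poly k p).
Local Notation W := (witt k p).

Let p_pr : prime p := pcharf_prime pk.
Let p_gt0 : (0 < p)%N := prime_gt0 p_pr.
Let p_gt1 : (1 < p)%N := prime_gt1 p_pr.
Let p1_lt : (p.-1 < p)%N. Proof. by rewrite prednK. Qed.

Lemma natr_neq0 n : (0 < n < p)%N -> n%:R != 0 :> k.
Proof.
case/andP=> n0 np; rewrite -(dvdn_pcharf pk); apply/negP => /(dvdn_leq n0).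
by rewrite leqNgt np.
Qed.

Lemma natr_inj_lt m n : (m < p)%N -> (n < p)%N -> m != n -> m%:R != n%:R :> k.
Proof.
wlog mn : m n / (m < n)%N => [H mp np|mp np _].
  by case: ltngtP => // mn _; [|rewrite eq_sym]; apply: H; rewrite ?ltn_eqF.
rewrite eq_sym -subr_eq0 -natrB 1?ltnW // natr_neq0 // subn_gt0 mn.
exact: leq_ltn_trans (leq_subr _ _) np.
Qed.

(** An [f] with [f(0) <> 0] is invertible, with inverse [f^(p-1) / f(0)^p]. *)
Lemma unit_cancel (f b : A) : f`_0 != 0 -> f * b = 0 -> b = 0.
Proof.
move=> f0 fb; apply/eqP.
have : f ^+ p.-1 * f * b = 0 by rewrite -mulrA fb mulr0.
rewrite -exprSr prednK // trunc_Frobenius // -scalerAl mul1r => /eqP.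
by rewrite scaler_eq0 expf_eq0 (negPf f0) andbF.
Qed.

Lemma dX_eq0 (a : A) : dX_fun a = 0 -> a = (a`_0)%:A.
Proof.
move=> a0; apply: (trunc_inj pk) => -[|m] mp; rewrite coefZ coef_trunc1 //.
  by rewrite mulr1.
have /eqP : (dX_fun a)`_m = 0 by rewrite a0 coef0.
rewrite mulr0 coef_dX ?(ltnW mp) // -mulr_natr mulf_eq0 (negPf (natr_neq0 _)) //.
by rewrite orbF => /eqP.
Qed.

Definition vanish (n : nat) (a : A) : Prop := forall m, (m < n)%N -> a`_m = 0.

(** The lowest terms of [f] and [g] contribute to [f g'] in degree [a + b - 1];
    the statement avoids the subtraction because [a + b] may be zero, and is
    then void. *)
Lemma coef_mul_dX a b (f g : A) m : vanish a f -> vanish b g ->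
  (m < p)%N -> (m.+1 = a + b)%N -> (f * dX_fun g)`_m = f`_a * g`_b *+ b.
Proof.
move=> fa gb mp mab; rewrite coef_truncM // coefM.
have [b0|b0] := posnP b.
  rewrite b0 mulr0n big1 // => i _; rewrite fa ?mul0r //.
  by rewrite b0 addn0 in mab; rewrite -mab.
have am : (a < m.+1)%N by rewrite mab -addn1 leq_add2l.
rewrite (bigD1 (Ordinal am)) //= [X in _ + X]big1 ?addr0; last first.
  move=> i; rewrite -val_eqE /= neq_ltn => /orP[ia|ai]; first by rewrite fa ?mul0r.
  rewrite coef_dX ?(leq_ltn_trans (leq_subr _ _)) // gb ?mul0rn ?mulr0 //.
  by have := ltn_ord i; move: ai mab; lia.
have mabE : (m - a).+1 = b by move: mab am; lia.
by rewrite coef_dX ?(leq_ltn_trans (leq_subr _ _)) // mabE mulrnAr.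
Qed.

Lemma vanish_mul_dX a b (f g : A) m : vanish a f -> vanish b g ->
  (m < p)%N -> (m.+1 < a + b)%N -> (f * dX_fun g)`_m = 0.
Proof.
move=> fa gb mp mab; rewrite coef_truncM // coefM big1 // => i _.
have [/fa ->|ai] := ltnP i a; first by rewrite mul0r.
rewrite coef_dX ?(leq_ltn_trans (leq_subr _ _)) // gb ?mul0rn ?mulr0 //.
by have := ltn_ord i; move: ai mab; lia.
Qed.

(** The functional [a |-> [X^(p-1)] (f^(p-1) a)] kills the image of [f D]: since
    [f^p] is a constant, this comes down to the absence of [X^(p-1)] in a
    derivative. *)
Lemma theta_dX (f a : A) : (f ^+ p.-1 * (f * dX_fun a))`_p.-1 = 0.
Proof.
rewrite mulrA -exprSr prednK // trunc_Frobenius // -scalerAl mul1r coefZ.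
rewrite coef_dX // prednK // -mulr_natr.
by rewrite (pcharf0 pk) !mulr0.
Qed.

Lemma coef0_exp (f : A) n : (f ^+ n)`_0 = f`_0 ^+ n.
Proof.
elim: n => [|n IHn]; first by rewrite expr0 coef_trunc1.
by rewrite exprS coef_truncM // coefM big_ord1 IHn exprS.
Qed.

Lemma coef_qXnM n (b : A) m : (m < p)%N ->
  ('qX ^+ n * b)`_m = if (m < n)%N then 0 else b`_(m - n).
Proof.
move=> mp; rewrite -in_qpolyXn.
have {1}-> : b = in_qpoly 'X^p (b : {poly k}).
  by apply/val_inj/esym/in_qpoly_small/size_mk_monic.
by rewrite -in_qpolyM coef_in_qpoly // coefXnM.
Qed.

Lemma exists_primitive (f : A) : f`_p.-1 = 0 -> exists u : A, dX_fun u = f.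
Proof.
move=> f0; exists (in_qpoly 'X^p (\poly_(i < p) (f`_i.-1 / i%:R))).
apply: (trunc_inj pk) => m mp; rewrite coef_dX //.
have [m1p|pm] := ltnP m.+1 p.
  rewrite coef_in_qpoly // coef_poly m1p /= -[LHS]mulr_natr divfK //.
  exact: natr_neq0.
have mE : m = p.-1 by move: mp pm; lia.
by rewrite mE prednK // f0 -mulr_natr (pcharf0 pk) mulr0.
Qed.

(** When [f(0) <> 0] this is [f(0)^p] times the coefficient of [X^(p-1)] in
    [1 / f], that is, the obstruction to finding a primitive of [1 / f].  Taking
    a power of [f] gives a polynomial in the coefficients of [f]. *)
Definition resid (x : W) : k := (symb x ^+ p.-1)`_p.-1.

Lemma resid_coef0 (x : W) : coefW 0 x = 0 -> resid x = coefW 1 x ^+ p.-1.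
Proof.
move=> x0; have [b bE] := trunc_const_add (symb x).
rewrite -/(coefW 0 x) x0 scale0r add0r in bE.
rewrite /resid /coefW bE exprMn coef_qXnM // ltnn subnn coef0_exp.
by rewrite -[qpolyX _]expr1 coef_qXnM.
Qed.

Lemma pmap0P (x : W) :
  nilp_var k p x <-> iter p (vsval x : A -> A) 'qX = 0.
Proof.
rewrite /nilp_var /=; split=> [x0|x0].
  by rewrite -pmap_act // x0 zero_lfunE.
by apply: symb_inj; rewrite linear0 /symb pmap_act.
Qed.

Lemma nilp_vanish (x : W) : coefW 0 x = 0 -> coefW 1 x = 0 -> nilp_var k p x.
Proof.
move=> x0 x1; have fx : vanish 2 (symb x) by case=> [|[|]].
have H n : vanish n.+1 (iter n (vsval x : A -> A) 'qX).
  elim: n => [|n IHn].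
    move=> [] // _.
    by rewrite -[qpolyX _]mulr1 -[qpolyX _]expr1 coef_qXnM.
  rewrite iterS symb_act // => m mn; have [mp|pm] := ltnP m p.
    by apply: (vanish_mul_dX fx IHn) => //; move: mn; lia.
  by rewrite nth_default // (leq_trans (size_trunc pk _)).
by apply/pmap0P; apply: (trunc_inj pk) => m mp; rewrite coef0 H // ltnW.
Qed.

(** Suppose the residue is not zero.  If [x^(n+2) X = 0], then [x^(n+1) X] is in
    the kernel of [x], hence constant, and also in the image of [x], hence zero
    by [theta_dX].  Descending from [x^p X = 0] one reaches [x X = 0], that is
    [f = 0]. *)
Lemma nilp_resid0 (x : W) : coefW 0 x != 0 -> nilp_var k p x -> resid x = 0.
Proof.
move=> x0 /pmap0P xp; apply/eqP; apply: contraT => h0.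
pose u n : A := iter n (vsval x : A -> A) 'qX.
have uE n : u n.+1 = symb x * dX_fun (u n) by rewrite /u iterS symb_act.
have down n : u n.+2 = 0 -> u n.+1 = 0.
  rewrite uE => /unit_cancel => /(_ x0)/dX_eq0 => uc.
  have := theta_dX (symb x) (u n); rewrite -uE uc.
  rewrite -scalerAr mulr1 coefZ => /eqP; rewrite mulf_eq0 (negPf h0) orbF.
  by move/eqP ->; rewrite scale0r.
(* [x X] is the symbol of [x], and its constant term is not zero. *)
have u1 : u 1%N = 0.
  have : u p.-1.+1 = 0 by rewrite prednK.
  by elim: p.-1 => // n IHn /down.
case/eqP: x0; rewrite /coefW /symb; move: u1; rewrite /u /= => ->.
exact: coef0.
Qed.

(** The vanishing residue gives [f^(p-1)] a primitive [u]; then [x u] is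
    constant and [x^2 u = 0].  Since [x^p] is again a derivation and [u'] is a
    unit, [x^p u = 0] forces [x^p = 0]. *)
Lemma resid0_nilp (x : W) : coefW 0 x != 0 -> resid x = 0 -> nilp_var k p x.
Proof.
move=> x0 /exists_primitive[u uE]; rewrite /nilp_var /=.
apply: symb_inj; rewrite linear0.
have xu : (vsval x : A -> A) u = (coefW 0 x ^+ p)%:A.
  by rewrite symb_act // uE -exprS prednK // trunc_Frobenius.
have xc c : (vsval x : A -> A) c%:A = 0.
  rewrite symb_act // linearZ /= (_ : dX_fun 1 = 0) ?scaler0 ?mulr0 //.
  apply: (trunc_inj pk) => m mp; rewrite coef0 coef_dX //.
  have [m1|m1] := ltnP m.+1 p; first by rewrite coef_trunc1 // mul0rn.
  by rewrite nth_default ?mul0rn // (leq_trans (size_trunc pk _)).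
have iter_xu n : (1 < n)%N -> iter n (vsval x : A -> A) u = 0.
  case: n => [|[|n]] // _.
  by rewrite 2!iterSr xu xc; elim: n => //= n ->; rewrite linear0.
have : vsval (Defs.pmap x) u = 0.
  by rewrite pmap_act // iter_xu.
rewrite symb_act // uE => /(congr1 (fun a => symb x * a)).
rewrite mulr0 mulrCA -exprS prednK // trunc_Frobenius // -scalerAr mulr1.
by move/eqP; rewrite scaler_eq0 expf_eq0 (negPf x0) andbF => /eqP.
Qed.

(** If [x] has order at least [1] it acts on [(X)/(X^2)] by its coefficient of
    [X]. *)
Lemma nilp_coef1 (x : W) : coefW 0 x = 0 -> nilp_var k p x -> coefW 1 x = 0.
Proof.
move=> x0 /pmap0P xp; have [b bE] := trunc_const_add (symb x).
rewrite -/(coefW 0 x) x0 scale0r add0r in bE.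
have H n : (iter n (vsval x : A -> A) 'qX)`_1 = b`_0 ^+ n.
  elim: n => [|n IHn].
    rewrite expr0 -[RHS](coef_trunc1 pk p_gt0) -(subnn 1%N).
    by rewrite -[iter 0 _ _]mulr1 -[iter 0 _ _]expr1 coef_qXnM.
  rewrite iterS symb_act // bE -mulrA -[qpolyX _]expr1 coef_qXnM // ltnn subnn.
  by rewrite coef_truncM // coefM big_ord1 coef_dX // expr1 IHn mulr1n exprS.
have := H p; rewrite xp coef0 => /esym/eqP; rewrite expf_eq0 => /andP[_ /eqP b0].
by rewrite /coefW bE -[qpolyX _]expr1 coef_qXnM.
Qed.

Lemma nilpP (x : W) : nilp_var k p x <-> resid x = 0.
Proof.
have [x0|x0] := eqVneq (coefW 0 x) 0; last first.
  by split; [exact: nilp_resid0 | exact: resid0_nilp].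
rewrite resid_coef0 //; split=> [/(nilp_coef1 x0) ->|/eqP].
  by rewrite expr0n -subn1 subn_eq0 leqNgt p_gt1.
by rewrite expf_eq0 => /andP[_ /eqP]; exact: nilp_vanish.
Qed.

(** Normalize [z = y - c x] to have no term in degree [a].  Were [m] the lowest
    degree of [z], the bracket of [x] and [z] would have in degree [a + m - 1]
    the coefficient [(m - a) x_a z_m], and [m - a] is not zero modulo [p] because
    [a] and [m] are distinct and less than [p].  The bound [m + a <= p] says
    that degree [a + m - 1] is not truncated. *)
Lemma centralizer_coef (x y : W) a : (a < p)%N -> vanish a (symb x) ->
  coefW a x != 0 -> lie_br x y = 0 ->
  forall m, (m < p)%N -> (m + a <= p)%N ->
    coefW m y = coefW a y / coefW a x * coefW m x.
Proof.
move=> ap va xa xy m; pose c := coefW a y / coefW a x; pose z := y - c *: x.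
have xz : symb x * dX_fun (symb z) = symb z * dX_fun (symb x).
  rewrite /z linearB linearZ linearB linearZ /= mulrBr mulrBl.
  by rewrite -scalerAr -scalerAl (bracket0P pk x y).1.
suff : (m < p)%N -> (m + a <= p)%N -> coefW m z = 0.
  move=> H mp mpa; apply/eqP; rewrite -subr_eq0; apply/eqP.
  by rewrite -(H mp mpa) /z coefWB coefWZ.
elim/ltn_ind: m => m IHm mp mpa.
have [->|ma] := eqVneq m a.
  by rewrite /z coefWB coefWZ /c divfK ?subrr.
have vz : vanish m (symb z).
  by move=> n nm; apply: IHm => //; move: nm mp mpa; lia.
have M1 : (m + a > 0)%N by move: ma; lia.
have Mp : ((m + a).-1 < p)%N by rewrite prednK.
have ME : ((m + a).-1.+1 = a + m)%N by rewrite prednK // addnC.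
have ME' : ((m + a).-1.+1 = m + a)%N by rewrite prednK.
have : coefW a x * coefW m z * (a%:R - m%:R) = 0.
  rewrite mulrBr !mulr_natr [X in X *+ a]mulrC -(coef_mul_dX vz va Mp ME') -xz.
  by rewrite (coef_mul_dX va vz Mp ME) subrr.
move/eqP; rewrite !mulf_eq0 (negPf xa) subr_eq0 /= => /orP[/eqP //|am].
by move: (natr_inj_lt mp ap ma); rewrite eq_sym am.
Qed.

Lemma commute_vanish (x y : W) a b : vanish a (symb x) -> vanish b (symb y) ->
  (p < a + b)%N -> lie_br x y = 0.
Proof.
move=> xa yb pab; apply/(bracket0P pk); apply: (trunc_inj pk) => m mp.
rewrite (vanish_mul_dX xa yb) ?(vanish_mul_dX yb xa) //.
  by rewrite addnC (leq_ltn_trans mp).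
exact: leq_ltn_trans pab.
Qed.

End Nilpotency.

(** * Density of the nilpotent elements of order zero *)

Section NilpotentDensity.
Variables (k : closedFieldType) (p : nat).
Hypothesis pk : p \in [pchar k].
Local Notation A := (trunc_poly k p).
Local Notation W := (witt k p).

Let p_pr : prime p := pcharf_prime pk.
Let p_gt0 : (0 < p)%N := prime_gt0 p_pr.
Let p_gt1 : (1 < p)%N := prime_gt1 p_pr.
Let p1_lt : (p.-1 < p)%N. Proof. by rewrite prednK. Qed.

(** Indexing by natural numbers avoids ordinal arithmetic in the formulas of
    [piece_param], where indices are shifted. *)
Definition nat_coord (v : 'I_p -> k) (n : nat) : k := oapp v 0 (insub n).

Lemma nat_coordE v (n : nat) (np : (n < p)%N) : nat_coord v n = v (Ordinal np).
Proof. by rewrite /nat_coord insubT. Qed.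

Lemma nat_coord_restr (u : nat -> k) n : (n < p)%N ->
  nat_coord (fun j : 'I_p => u j) n = u n.
Proof. by move=> np; rewrite nat_coordE. Qed.

Lemma nat_coord_mpoly n : exists q : {mpoly k[p]}, forall v, nat_coord v n = q.@[v].
Proof.
have [np|pn] := ltnP n p.
  by exists 'X_(Ordinal np) => v; rewrite mevalXU nat_coordE.
by exists 0 => v; rewrite meval0 /nat_coord insubN // -leqNgt.
Qed.

(** The polynomial [g] without term [X^(p-1)] in [f = g^(p-1)].  Up to scalars
    [g] is [1 / f], so the equation of the nilpotent variety becomes linear in
    terms of [g]. *)
Definition root_symb (v : 'I_p -> k) : A :=
  in_qpoly 'X^p (\poly_(m < p.-1) nat_coord v m).

Definition nilp_param (v : 'I_p -> k) : W := of_symb (root_symb v ^+ p.-1).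

Lemma symb_nilp_param v : symb (nilp_param v) = root_symb v ^+ p.-1.
Proof. exact: of_symbK. Qed.

(** Because [(p-1)^2 = p (p-2) + 1] and [p]-th powers are constants: taking
    [(p-1)]-th powers is an involution up to scalars. *)
Lemma exp_pred_pred (f : A) :
  f ^+ (p.-1 * p.-1) = (f`_0 ^+ (p * p.-2)) *: f.
Proof.
have -> : (p.-1 * p.-1 = p * p.-2 + 1)%N by move: p_gt1; nia.
by rewrite exprD expr1 exprM trunc_Frobenius // exprZn expr1n -scalerAl mul1r exprM.
Qed.

Lemma coef_root_symb v : (root_symb v)`_p.-1 = 0.
Proof. by rewrite coef_in_qpoly // coef_poly ltnn. Qed.

Lemma nilp_nilp_param v : nilp_var k p (nilp_param v).
Proof.
apply/(nilpP pk); rewrite /resid symb_nilp_param -exprM exp_pred_pred coefZ.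
by rewrite coef_root_symb mulr0.
Qed.

(** The scalar left over by [exp_pred_pred] is absorbed by extracting a
    [(p-1)]-th root in [k]. *)
Lemma regular_nilp_param (x : W) : coefW 0 x != 0 -> nilp_var k p x ->
  exists v, x = nilp_param v.
Proof.
move=> x0 /(nilpP pk) rx.
have [d dE] : exists d : k, d ^+ p.-1 * coefW 0 x ^+ (p * p.-2) = 1.
  have [|d /rootP] :=
    closed_rootP ('X^(p.-1) - (coefW 0 x ^- (p * p.-2))%:P : {poly k}) _.
    by rewrite size_XnsubC ?ltn_predRL // eqSS -lt0n ltn_predRL.
  rewrite !hornerE => /eqP; rewrite subr_eq0 => /eqP dE.
  by exists d; rewrite dE mulVf // expf_neq0.
pose G : A := d *: symb x ^+ p.-1.
exists (fun j => G`_j); apply: (symb_inj); rewrite symb_nilp_param.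
suff -> : root_symb (fun j => G`_j) = G.
  rewrite /G exprZn -exprM exp_pred_pred scalerA -/(coefW 0 x) dE scale1r //.
apply: (trunc_inj pk) => m mp; rewrite coef_in_qpoly // coef_poly.
case: ltnP => mp1; first by rewrite (nat_coord_restr (fun j => G`_j)).
have -> : m = p.-1 by move: mp mp1; lia.
by rewrite /G coefZ -/(resid x) rx mulr0.
Qed.

(** The residue of [Y + s + t X] as a polynomial in [t] with coefficients in
    [k[s]]: it is the binomial expansion of [(t X + (s + Y))^n] in which only the
    coefficient of [X^n] is kept. *)
Definition resid_poly (n : nat) (Y : {poly k}) : {poly {poly k}} :=
  \sum_(i < n.+1)
    ((('X%:P + map_poly polyC Y) ^+ i)`_i *+ 'C(n, i)) *: 'X^(n - i).

Lemma resid_poly_monic n Y : resid_poly n Y \is monic.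
Proof.
rewrite /resid_poly big_ord_recl /= expr0 coef1 bin0 scale1r subn0 monicE.
rewrite lead_coefDl ?lead_coefXn // size_polyXn ltnS.
apply: (leq_trans (size_sum _ _ _)); apply/bigmax_leqP => i _.
apply: (leq_trans (size_scale_leq _ _)); rewrite size_polyXn /bump /= add1n.
by have := ltn_ord i; lia.
Qed.

Lemma resid_polyE (x : W) s t :
  resid (x + s *: witt_XD k p 0 + t *: witt_XD k p 1) =
  (resid_poly p.-1 (symb x)).[t%:P].[s].
Proof.
pose Y : {poly k} := symb x; rewrite /resid.
have -> : symb (x + s *: witt_XD k p 0 + t *: witt_XD k p 1) =
    in_qpoly 'X^p (t *: 'X + (s%:P + Y)).
  apply: (trunc_inj pk) => m mp; rewrite -/(coefW m _) !coefWD !coefWZ !coefW_XD //.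
  rewrite coef_in_qpoly // !coefD coefZ coefX coefC addrC -/(coefW m x).
  congr (_ + _); rewrite addrC; congr (_ + _).
  by case: (m == 0%N); rewrite ?mulr1 ?mulr0.
rewrite -rmorphXn coef_in_qpoly // exprDn coef_sum /resid_poly !horner_sum.
apply: eq_bigr => i _; rewrite coefMn exprZn -scalerAl coefZ coefXnM.
rewrite ltnNge leq_subr /= subKn -1?ltnS ?ltn_ord // mulrC -mulrnAl.
rewrite !hornerZ hornerXn hornerM -polyC_exp hornerC hornerMn; congr (_ *+ _ * _).
have -> : s%:P + Y = map_poly (horner_eval s) ('X%:P + map_poly polyC Y).
  rewrite rmorphD /= map_polyC -map_poly_comp /= {1}/horner_eval hornerX.
  by rewrite map_poly_id // => c _; rewrite /= /horner_eval hornerC.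
by rewrite -rmorphXn coef_map.
Qed.

(** Nilpotent elements of order zero are images of [nilp_param].  Another
    nilpotent [x] lies on the plane of the [x + s D + t X D], where the residue
    is monic in [t] and where the points with [s <> 0] and residue zero are of
    the former kind; [root_specialization] passes to [s = t = 0]. *)
Lemma nilp_dense (g : W -> k) : polyfun g -> (forall v, g (nilp_param v) = 0) ->
  forall x, nilp_var k p x -> g x = 0.
Proof.
move=> pg gv.
have greg x : coefW 0 x != 0 -> nilp_var k p x -> g x = 0.
  by move=> x0 /(regular_nilp_param x0)[v ->].
move=> x xn; have [x0|/greg] := eqVneq (coefW 0 x) 0; last exact.
have [G GE] := polyfun_plane x (witt_XD k p 0) (witt_XD k p 1) pg.
rewrite -[x]addr0 -[x]addr0 -[X in x + X](scale0r (witt_XD k p 0)).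
rewrite -[X in _ + _ + X](scale0r (witt_XD k p 1)) GE.
apply: (root_specialization (resid_poly_monic p.-1 (symb x))).
  move=> s t s0; rewrite -resid_polyE -GE => rx; apply: greg.
    by rewrite !coefWD !coefWZ !coefW_XD // x0 mulr1 mulr0 add0r addr0.
  exact/(nilpP pk).
by rewrite -resid_polyE !scale0r !addr0; exact/(nilpP pk).
Qed.

End NilpotentDensity.

(** * Parametrization of the pieces *)

(** Shared by the functions on a vector space and by the functions of the
    parameters, so that polynomiality of the coefficients of products and powers
    is proved once. *)
Definition fun_subalgebra (k : fieldType) (T : Type) (P : (T -> k) -> Prop) : Prop :=
  [/\ forall c, P (fun=> c),
      forall g h, P g -> P h -> P (fun t => g t + h t)
    & forall g h, P g -> P h -> P (fun t => g t * h t)].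

Lemma polyfun_subalgebra (k : fieldType) (V : vectType k) :
  fun_subalgebra (@polyfun k V).
Proof. by split; [exact: polyfun_cst | exact: polyfunD | exact: polyfunM]. Qed.

Definition is_mpoly (k : fieldType) n (g : ('I_n -> k) -> k) : Prop :=
  exists q : {mpoly k[n]}, forall v, g v = q.@[v].

Lemma is_mpoly_subalgebra (k : fieldType) n : fun_subalgebra (@is_mpoly k n).
Proof.
split=> [c|g h [f fE] [f' fE']|g h [f fE] [f' fE']].
- by exists c%:MP => v; rewrite mevalC.
- by exists (f + f') => v; rewrite mevalD fE fE'.
- by exists (f * f') => v; rewrite mevalM fE fE'.
Qed.

Section Subalgebra.
Variables (k : closedFieldType) (p : nat) (T : Type) (P : (T -> k) -> Prop).
Hypothesis pk : p \in [pchar k].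
Hypothesis Palg : fun_subalgebra P.
Local Notation A := (trunc_poly k p).

Lemma subalgebra_sum (I : Type) (r : seq I) (g : I -> T -> k) :
  (forall i, P (g i)) -> P (fun t => \sum_(i <- r) g i t).
Proof.
have [Pc Pa _] := Palg; move=> Pg; elim: r => [|i r IHr].
  rewrite (_ : (fun _ => _) = fun=> 0) //.
  by apply/funext => t; rewrite big_nil.
rewrite (_ : (fun _ => _) = fun t => g i t + \sum_(i <- r) g i t).
  exact: Pa.
by apply/funext => t; rewrite big_cons.
Qed.

Definition coefs_in (F : T -> A) : Prop := forall m, P (fun t => (F t)`_m).

Lemma coefs_inP (F : T -> A) :
  (forall m, (m < p)%N -> P (fun t => (F t)`_m)) -> coefs_in F.
Proof.
move=> FP m; have [/FP //|pm] := ltnP m p.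
have [Pc _ _] := Palg; rewrite (_ : (fun _ => _) = fun=> 0) //.
by apply/funext => t; rewrite nth_default // (leq_trans (size_trunc pk _)).
Qed.

Lemma coefs_inM (F G : T -> A) :
  coefs_in F -> coefs_in G -> coefs_in (fun t => F t * G t).
Proof.
move=> PF PG; apply: coefs_inP => m mp.
rewrite (_ : (fun _ => _) = fun t => \sum_(i < m.+1) (F t)`_i * (G t)`_(m - i)).
  by have [_ _ Pm] := Palg; apply: subalgebra_sum => i; apply: Pm.
by apply/funext => t; rewrite coef_truncM // coefM.
Qed.

Lemma coefs_inX (F : T -> A) n : coefs_in F -> coefs_in (fun t => F t ^+ n).
Proof.
move=> PF; elim: n => [|n IHn].
  by move=> m; have [Pc _ _] := Palg; exact: (Pc (1 : A)`_m).
rewrite (_ : (fun _ => _) = fun t => F t * F t ^+ n); first exact: coefs_inM.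
by apply/funext => t; rewrite exprS.
Qed.

Lemma coefs_in_dX (F : T -> A) : coefs_in F -> coefs_in (fun t => dX_fun (F t)).
Proof.
move=> PF; apply: coefs_inP => m mp.
rewrite (_ : (fun _ => _) = fun t => m.+1%:R * (F t)`_m.+1).
  by have [Pc _ Pm] := Palg; apply: Pm.
by apply/funext => t; rewrite coef_dX // mulr_natl.
Qed.

Lemma coefs_inB (F G : T -> A) :
  coefs_in F -> coefs_in G -> coefs_in (fun t => F t - G t).
Proof.
have [Pc Pa Pm] := Palg; move=> PF PG m.
rewrite (_ : (fun _ => _) = fun t => (F t)`_m + -1 * (G t)`_m).
  by apply: Pa => //; apply: Pm.
by apply/funext => t; rewrite coefB mulN1r.
Qed.

End Subalgebra.

Section Pieces.
Variables (k : closedFieldType) (p : nat).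
Hypothesis pk : p \in [pchar k].
Local Notation A := (trunc_poly k p).
Local Notation W := (witt k p).
Local Notation WW := (witt k p * witt k p)%type.

Lemma fst_scalar (V1 V2 : vectType k) (l : V1 -> k) :
  scalar l -> scalar (fun xy : V1 * V2 => l xy.1).
Proof. by move=> ls a [x y] [x' y']; exact: ls. Qed.

Lemma snd_scalar (V1 V2 : vectType k) (l : V2 -> k) :
  scalar l -> scalar (fun xy : V1 * V2 => l xy.2).
Proof. by move=> ls a [x y] [x' y']; exact: ls. Qed.

Lemma polyfun_coef1 m : polyfun (fun xy : WW => coefW m xy.1).
Proof. by apply/polyfun_scalar/fst_scalar; exact: coefW_scalar. Qed.

Lemma polyfun_coef2 m : polyfun (fun xy : WW => coefW m xy.2).
Proof. by apply/polyfun_scalar/snd_scalar; exact: coefW_scalar. Qed.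

Lemma zclosed_nilp_comm : zclosed (nilp_comm_var k p).
Proof.
have PA := @polyfun_subalgebra k WW.
have c1 : coefs_in (@polyfun k WW) (fun xy => symb xy.1) by exact: polyfun_coef1.
have c2 : coefs_in (@polyfun k WW) (fun xy => symb xy.2) by exact: polyfun_coef2.
(* The equations are indexed by [nat]: the coefficients of the bracket below
   [p], and the two residues at [p] and [p.+1]. *)
rewrite (_ : nilp_comm_var k p = [set xy : WW | forall m : nat, True ->
   (if m == p then resid xy.1 else if m == p.+1 then resid xy.2
    else coefW m (lie_br xy.1 xy.2)) = 0]).
  apply: zclosed_polyfun => m.
  case: eqP => _; first exact: (coefs_inX pk PA).
  case: eqP => _; first exact: (coefs_inX pk PA).
  rewrite (_ : (fun _ => _) = fun xy : WW =>
     (symb xy.1 * dX_fun (symb xy.2) - symb xy.2 * dX_fun (symb xy.1))`_m).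
    by apply: coefs_inB => //; apply: coefs_inM => //; exact: coefs_in_dX.
  by apply/funext => xy; rewrite /coefW (symb_bracket pk).
apply/seteqP; split=> -[x y] /=.
  case=> /= /(nilpP pk) rx /(nilpP pk) ry xy m _.
  by rewrite xy rx ry /coefW linear0 coef0; do 2?case: ifP.
move=> H; split=> /=.
- by apply/(nilpP pk); have := H p I; rewrite eqxx.
- by apply/(nilpP pk); have := H p.+1 I; rewrite eqxx gtn_eqF.
- apply: (coefW_inj pk) => m mp; have := H m I; rewrite /coefW linear0 coef0.
  by rewrite !ltn_eqF ?leqW.
Qed.

Lemma polymap_pair (V1 V2 : vectType k) n (f : ('I_n -> k) -> V1)
    (g : ('I_n -> k) -> V2) :
  polymap f -> polymap g -> polymap (fun v => (f v, g v) : V1 * V2).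
Proof.
move=> pf pg l ls.
have lE x y : l (x, y) = l (x, 0) + l (0, y).
  have [L LE] := scalar_pack ls; rewrite -!LE -linearD /=; congr (L _).
  by rewrite -[RHS]/(x + 0, 0 + y) addr0 add0r.
have [|q qE] := pf (fun x => l (x, 0)).
  move=> a x x'; rewrite -ls; congr l.
  by rewrite -[RHS]/(a *: x + x', a *: 0 + 0) scaler0 addr0.
have [|r rE] := pg (fun y => l (0, y)).
  move=> a x x'; rewrite -ls; congr l.
  by rewrite -[RHS]/(a *: 0 + 0, a *: x + x') scaler0 addr0.
by exists (q + r) => v; rewrite lE mevalD qE rE.
Qed.

Lemma polymap_witt_of_coefs n (c : ('I_n -> k) -> nat -> k) :
  (forall m, is_mpoly (c^~ m)) -> polymap (fun v => witt_of_coefs p (c v)).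
Proof.
move=> /choice[q qE]; apply: (@polymap_sum _ _ _ _ (fun i : 'I_p => q i)) => v.
by rewrite /witt_of_coefs; apply: eq_bigr => i _; rewrite qE.
Qed.

Lemma polymap_nilp : polymap (@nilp_param k p).
Proof.
have MA := @is_mpoly_subalgebra k p.
apply: (polymap_witt_of_coefs (c := fun v m => (root_symb v ^+ p.-1)`_m)) => m.
apply: (coefs_inX pk MA); apply: (coefs_inP pk MA) => {}m mp.
have [mp1|pm] := ltnP m p.-1.
  have [q qE] := @nat_coord_mpoly k p m; exists q => v.
  by rewrite coef_in_qpoly // coef_poly mp1.
by exists 0 => v; rewrite coef_in_qpoly // coef_poly ltnNge pm /= meval0.
Qed.

(** For [i > 0] the parameters of index greater than [i] are the coefficients of
    [x], the one of index [i] is the factor [c], and those of index less than [i]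
    are the coefficients of [z] from degree [p - i] on: [y = c x + z].  For
    [i = 0] the last parameter, which does not occur in [nilp_param], is the
    factor. *)
Definition piece_param (i : nat) (v : 'I_p -> k) : WW :=
  if i == 0%N then (nilp_param v, nat_coord v p.-1 *: nilp_param v)
  else let x m := if (i < m)%N then nat_coord v m else 0 in
    (witt_of_coefs p x, witt_of_coefs p (fun m =>
      nat_coord v i * x m + (if (p - i <= m)%N then nat_coord v (m - (p - i)) else 0))).

Lemma polymap_scale (V : vectType k) n (g : ('I_n -> k) -> k)
    (f : ('I_n -> k) -> V) :
  is_mpoly g -> polymap f -> polymap (fun v => g v *: f v).
Proof.
move=> [q qE] pf l ls; have [r rE] := pf l ls; exists (q * r) => v.
by have [L LE] := scalar_pack ls; rewrite -LE linearZ /= LE rE mevalM qE.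
Qed.

Lemma polymap_piece i : polymap (piece_param i).
Proof.
have [Pc Pa Pm] := @is_mpoly_subalgebra k p.
have Pe n : is_mpoly (fun v : 'I_p -> k => nat_coord v n) by exact: nat_coord_mpoly.
have Px m : is_mpoly (fun v : 'I_p -> k => if (i < m)%N then nat_coord v m else 0).
  by case: (i < m)%N; [exact: Pe | exact: Pc].
rewrite /piece_param; case: (i == 0%N); apply: polymap_pair.
- exact: polymap_nilp.
- apply: (@polymap_scale _ _ (fun v => nat_coord v p.-1)); first exact: Pe.
  exact: polymap_nilp.
- apply: (polymap_witt_of_coefs
    (c := fun v m => if (i < m)%N then nat_coord v m else 0)) => m.
  exact: Px.
- apply: (polymap_witt_of_coefs (c := fun v m =>
    nat_coord v i * (if (i < m)%N then nat_coord v m else 0)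
    + (if (p - i <= m)%N then nat_coord v (m - (p - i)) else 0))) => m.
  apply: Pa; first exact: Pm.
  by case: (p - i <= m)%N; [exact: Pe | exact: Pc].
Qed.

End Pieces.

(** * The decomposition *)

Section Decomposition.
Variables (k : closedFieldType) (p : nat).
Hypothesis pk : p \in [pchar k].
Hypothesis p_gt3 : (3 < p)%N.
Local Notation A := (trunc_poly k p).
Local Notation W := (witt k p).
Local Notation WW := (witt k p * witt k p)%type.
Local Notation q := ((p - 3)./2).

Let p_pr : prime p := pcharf_prime pk.

Lemma half_pE : p = (2 * q + 3)%N.
Proof.
have op : odd p by case: (even_prime p_pr) p_gt3 => // ->.
have := odd_double_half (p - 3); rewrite oddB 1?ltnW // op /=.
by rewrite -mul2n; move: p_gt3; lia.
Qed.

Lemma witt_filtP (i : nat) (x : W) :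
  reflect (vanish i.+1 (symb x)) (x \in witt_filt k p i%:Z).
Proof.
have condE (m : 'I_p) : (i%:Z <= m%:Z - 1) = (i < m)%N by lia.
apply: (iffP idP) => [/memv_sumP[u ux ->] n ni|xi].
  rewrite -/(coefW n _); have [L LE] := scalar_pack (@coefW_scalar k p n).
  rewrite -LE linear_sum big1 // => m; rewrite condE => im.
  have /vlineP[c ->] : u m \in <[witt_XD k p m]>%VS by apply: ux; rewrite condE.
  by rewrite linearZ /= LE coefW_XD // ltn_eqF ?mulr0 // (leq_trans ni).
rewrite -(symbK pk x) /of_symb /witt_of_coefs.
rewrite (bigID (fun m : 'I_p => i%:Z <= m%:Z - 1)) /=.
rewrite [X in _ + X]big1 ?addr0; last first.
  by move=> m; rewrite condE -leqNgt => mi; rewrite xi ?scale0r.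
by apply: memv_sumr => m _; apply/memvZ/memv_line.
Qed.

Lemma witt_filtSP (i : nat) (x : W) :
  reflect (vanish i.+2 (symb x)) (x \in witt_filt k p (i%:Z + 1)).
Proof. by rewrite (_ : i%:Z + 1 = i.+1%:Z) //; [exact: witt_filtP | lia]. Qed.

Lemma vanishS n (x : W) : vanish n (symb x) -> coefW n x = 0 -> vanish n.+1 (symb x).
Proof.
by move=> vx x0 m; rewrite ltnS leq_eqVlt => /orP[/eqP->|/vx].
Qed.

Lemma vanish_le m n (f : A) : (m <= n)%N -> vanish n f -> vanish m f.
Proof. by move=> mn vf i im; apply: vf; exact: leq_trans mn. Qed.

Lemma vanish_lin n c (x y : W) : vanish n (symb x) -> vanish n (symb y) ->
  vanish n (symb (c *: x + y)).
Proof.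
move=> vx vy m mn; rewrite -/(coefW m _) coefWD coefWZ.
by rewrite (vx m mn : coefW m x = 0) (vy m mn : coefW m y = 0) mulr0 addr0.
Qed.

Lemma vanish_XD m n : (n < p)%N -> (m <= n)%N -> vanish m (symb (witt_XD k p n)).
Proof.
move=> np mn i im; rewrite -/(coefW i _) coefW_XD // ltn_eqF //.
exact: leq_trans mn.
Qed.

Lemma vanish0 n : vanish n (symb (0 : W)).
Proof. by move=> m _; rewrite linear0 coef0. Qed.

Lemma nilp_vanish2 (x : W) : vanish 2 (symb x) -> nilp_var k p x.
Proof. by move=> vx; apply: nilp_vanish => //; exact: vx. Qed.

Lemma exists_order (x : W) : x <> 0 ->
  exists a, [/\ (a < p)%N, vanish a (symb x) & coefW a x != 0].
Proof.
move=> x0; have [a [ap xa]] : exists a, (a < p)%N /\ coefW a x != 0.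
  apply: contrapT => H; apply: x0; apply: (coefW_inj pk) => m mp.
  rewrite /coefW linear0 coef0; apply/eqP; apply: contrapT => /negP xm.
  by apply: H; exists m.
have ex : exists a, coefW a x != 0 by exists a.
case: (ex_minnP ex) => b xb bmin; exists b; split=> //.
  exact: leq_ltn_trans (bmin a xa) ap.
move=> m mb; apply/eqP; apply: contraLR mb => xm.
by rewrite -leqNgt bmin.
Qed.

Lemma bracket_shift c (x y : W) : lie_br x (y - c *: x) = 0 -> lie_br x y = 0.
Proof.
move/(bracket0P pk) => H; apply/(bracket0P pk).
move: H; rewrite linearB linearZ linearB linearZ /= mulrBr mulrBl.
by rewrite -scalerAr -scalerAl => /addIr.
Qed.

Lemma bracketC (x y : W) : lie_br x y = 0 -> lie_br y x = 0.
Proof. by move/(bracket0P pk) => H; apply/(bracket0P pk). Qed.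

Lemma bracket_diag (x : W) a : lie_br x (a *: x) = 0.
Proof.
apply: (@bracket_shift a); rewrite subrr; apply/(bracket0P pk).
by rewrite !linear0 mulr0 mul0r.
Qed.

Lemma bracket_line (x y : W) t : lie_br x y = 0 -> lie_br (x + t *: y) y = 0.
Proof.
move=> /bracketC xy; apply: bracketC; apply: (@bracket_shift t).
by rewrite addrK.
Qed.

(** The pairs [(x, c x + z)] with [x] in [g_i] and [z] in [g_(p-1-i)].  Unlike in
    [stratum], [x] may lie in [g_(i+1)], which makes this the image of an affine
    space; the closures coincide by [stratum_sub] and [piece_set_sub]. *)
Definition piece_set (i : nat) : set WW :=
  [set xy | exists c, vanish i.+1 (symb xy.1)
                   /\ vanish (p - i) (symb (xy.2 - c *: xy.1))].

Lemma range_piece i : (0 < i)%N -> (i <= q)%N ->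
  range (@piece_param k p i) = piece_set i.
Proof.
move=> i0 iq; have pE := half_pE; rewrite /piece_param gtn_eqF //.
apply/seteqP; split=> [_ [v _ <-]|[x y] /= [c [vx vz]]].
  exists (nat_coord v i) => /=; split=> m mi.
    by rewrite -/(coefW m _) coef_witt_of_coefs // ?ltnNge -1?ltnS ?mi //; lia.
  rewrite -/(coefW m _) coefWB coefWZ !coef_witt_of_coefs //; try lia.
  by rewrite [(p - i <= m)%N]leqNgt mi addr0 subrr.
(* The inverse of the indexing in [piece_param]. *)
pose u j := if (j < i)%N then coefW (j + (p - i)) (y - c *: x)
            else if j == i then c else coefW j x.
exists (fun j => u j) => //; congr pair; apply: (coefW_inj pk) => m mp.
  rewrite coef_witt_of_coefs //; case: ltnP => im; last by rewrite [RHS]vx.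
  by rewrite (nat_coord_restr u) // /u ltnNge ltnW //= gtn_eqF.
have ip : (i < p)%N by lia.
rewrite coef_witt_of_coefs // (nat_coord_restr u) // {1}/u ltnn eqxx.
have -> : (if (i < m)%N then nat_coord (fun j : 'I_p => u j) m else 0) = coefW m x.
  case: ltnP => im; last by rewrite [RHS]vx.
  by rewrite (nat_coord_restr u) // /u ltnNge ltnW //= gtn_eqF.
have -> : (if (p - i <= m)%N then nat_coord (fun j : 'I_p => u j) (m - (p - i)) else 0)
    = coefW m (y - c *: x).
  case: leqP => mi; last by rewrite [RHS]vz.
  rewrite (nat_coord_restr u); last by lia.
  by rewrite /u ifT; [rewrite subnK | lia].
by rewrite coefWB coefWZ addrC subrK.
Qed.

Lemma piece_set_nilp_comm i : (0 < i)%N -> (i <= q)%N ->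
  piece_set i `<=` nilp_comm_var k p.
Proof.
move=> i0 iq [x y] /= [c [vx vz]]; have pE := half_pE; split=> /=.
- by apply: nilp_vanish2; exact: vanish_le vx.
- rewrite -(subrK (c *: x) y) addrC; apply: nilp_vanish2; apply: vanish_lin.
    exact: vanish_le vx.
  by apply: vanish_le vz; lia.
- apply: (bracket_shift (c := c)); apply: (commute_vanish pk vx vz); lia.
Qed.

Definition stratum (i : nat) : set WW :=
  [set xy | [/\ nilp_var k p xy.1, nilp_var k p xy.2,
      xy.1 \in witt_filt k p i%:Z, xy.1 \notin witt_filt k p (i%:Z + 1)
      & lie_br xy.1 xy.2 = 0]].

Lemma stratumP i (x y : W) : (0 < i)%N -> nilp_comm_var k p (x, y) ->
  vanish i.+1 (symb x) -> coefW i.+1 x != 0 -> stratum i (x, y).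
Proof.
move=> i0 [/= nx ny xy] vx xi; split=> //=; first exact/witt_filtP.
apply/negP => /witt_filtSP H; case/eqP: xi; exact: H.
Qed.

Lemma stratum_sub i : (i <= q)%N -> stratum i `<=` piece_set i.
Proof.
move=> iq [x y] [/= _ _ /witt_filtP vx nvx xy]; have pE := half_pE.
have xi : coefW i.+1 x != 0.
  by apply: contra nvx => /eqP xi; apply/witt_filtSP; exact: vanishS.
exists (coefW i.+1 y / coefW i.+1 x); split=> //= m mi.
rewrite -/(coefW m _) coefWB coefWZ (centralizer_coef pk _ vx xi xy) ?subrr //; lia.
Qed.

(** Moving [x] by a multiple of [e = X^(i+1) D] and [y] by [c] times the same
    multiple keeps [z] fixed and brings [x] out of [g_(i+1)]. *)
Lemma piece_set_sub i : (0 < i)%N -> (i <= q)%N ->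
  piece_set i `<=` zclosure (stratum i).
Proof.
move=> i0 iq [x y] [/= c [vx vz]]; have pE := half_pE.
pose e : W := witt_XD k p i.+1; have ip : (i.+1 < p)%N by lia.
apply: (@zclosed_line k _ _ _ (e, c *: e) ('X + (coefW i.+1 x)%:P)).
- exact: zclosed_closure.
- by rewrite -size_poly_eq0 size_XaddC.
move=> t; rewrite !hornerE => xt; apply: sub_zclosure.
change (stratum i (x + t *: e, y + t *: (c *: e))).
have vxe : vanish i.+1 (symb (x + t *: e)).
  by rewrite addrC; apply: vanish_lin => //; exact: vanish_XD.
apply: stratumP => //; last by rewrite coefWD coefWZ coefW_XD // eqxx mulr1 addrC.
apply: piece_set_nilp_comm i0 iq _ _; exists c; split=> //=.
by rewrite scalerDr !scalerA [t * c]mulrC opprD addrACA subrr addr0.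
Qed.

Lemma zclosure_eq (V : vectType k) (S T : set V) :
  S `<=` zclosure T -> T `<=` zclosure S -> zclosure S = zclosure T.
Proof.
by move=> ST TS; apply/seteqP; split; apply: zclosure_sub => //;
  exact: zclosed_closure.
Qed.

Lemma polyfun_comp (V1 V2 : vectType k) (L : V1 -> V2) (g : V2 -> k) :
  linear L -> polyfun g -> polyfun (fun v => g (L v)).
Proof.
move=> Llin [f fE]; apply: (@polyfun_ext _ _ (fun v => f.@[fun i => coords (L v) i])).
  by move=> v; rewrite fE.
apply: (@polyfun_meval k V1 _ f (fun i v => coords (L v) i)) => i.
by apply: polyfun_scalar => a u v; rewrite Llin coords_scalar.
Qed.

Definition set_last (v : 'I_p -> k) (a : k) : 'I_p -> k :=
  fun j => if j == p.-1 :> nat then a else v j.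

Lemma nat_coord_set_last v a : nat_coord (set_last v a) p.-1 = a.
Proof.
have p1 : (p.-1 < p)%N by move: p_gt3; lia.
by rewrite (nat_coordE _ p1) /set_last eqxx.
Qed.

Lemma nilp_param_set_last v a : nilp_param (set_last v a) = nilp_param v.
Proof.
rewrite /nilp_param /root_symb; congr (of_symb (in_qpoly _ _ ^+ _)).
apply/polyP => m; rewrite !coef_poly; case: ltnP => // mp1.
have mp : (m < p)%N by move: mp1; lia.
by rewrite !(nat_coordE _ mp) /set_last /= ltn_eqF.
Qed.

(** For [i = 0] the pairs [(x, a x)] with [x] of order zero are in the image, and
    the others are limits of them by [nilp_dense], applied to the restriction of
    a polynomial function to the graph of multiplication by [a]. *)
Lemma comm_pieceE i : (i <= q)%N ->
  comm_piece k p i = zclosure (range (@piece_param k p i)).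
Proof.
move=> iq; rewrite /comm_piece; case: posnP => [->|i0].
  apply: zclosure_eq => [_ [x [a [nx ->]]]|_ [v _ <-]]; last first.
    apply: sub_zclosure; exists (nilp_param v), (nat_coord v p.-1); split=> //.
    exact: nilp_nilp_param.
  apply/zclosureP => g pg gv.
  apply: (nilp_dense pk (g := fun x => g (x, a *: x))) => //.
    apply: (polyfun_comp (L := fun x : W => (x, a *: x) : WW)) pg => c u w.
    rewrite -[RHS]/(c *: u + w, c *: (a *: u) + a *: w); congr pair.
    by rewrite scalerDr !scalerA mulrC.
  move=> v; apply: gv; exists (set_last v a); first exact: I.
  by rewrite /piece_param eqxx nat_coord_set_last nilp_param_set_last.
rewrite range_piece //; apply: zclosure_eq; last exact: piece_set_sub.
by apply: subset_trans (stratum_sub iq) _; exact: sub_zclosure.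
Qed.

Lemma zclosed_piece i : zclosed (comm_piece k p i).
Proof. by rewrite /comm_piece; case: ifP => _; exact: zclosed_closure. Qed.

Lemma zirreducible_piece i : (i <= q)%N -> zirreducible (comm_piece k p i).
Proof.
move=> iq; rewrite comm_pieceE //; apply: zirreducible_closure.
by apply: zirreducible_image; exact: polymap_piece.
Qed.

Lemma sub_piece0 (x : W) a : nilp_var k p x -> comm_piece k p 0 (x, a *: x).
Proof. by move=> nx; apply: sub_zclosure; exists x, a. Qed.

Lemma piece_set_piece i : (0 < i)%N -> (i <= q)%N ->
  piece_set i `<=` comm_piece k p i.
Proof.
move=> i0 iq; rewrite comm_pieceE // range_piece //; exact: sub_zclosure.
Qed.

Lemma stratum_piece i : (0 < i)%N -> (i <= q)%N -> stratum i `<=` comm_piece k p i.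
Proof.
move=> i0 iq; apply: subset_trans (piece_set_piece i0 iq).
exact: stratum_sub.
Qed.

Lemma piece_nilp_comm i : (i <= q)%N -> comm_piece k p i `<=` nilp_comm_var k p.
Proof.
move=> iq; have cl := zclosed_nilp_comm pk.
case: (posnP i) => [->|i0].
  apply: zclosure_sub => // _ [x [a [nx ->]]]; split=> //=; last exact: bracket_diag.
  apply/(nilpP pk); move/(nilpP pk): nx; rewrite /resid linearZ exprZn coefZ => ->.
  by rewrite mulr0.
rewrite comm_pieceE // range_piece //; apply: zclosure_sub => //.
exact: piece_set_nilp_comm.
Qed.

(** Let [a] be the order of [x].  If [a = 0], [y] is a multiple of [x]; if
    [a <= q + 1], the pair is in a stratum.  Otherwise the description of
    centralizers says little about [y]; let [b] be its order.  If
    [b <= q + 1], then [x + t y] has order [b] for [t <> 0], and [(x + t y, y)]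
    is in the stratum of index [b - 1].  If both orders exceed [q + 1], only
    the coefficients of degree [q + 2] prevent [(x, y)] from being in the last
    piece, and they are proportional, after replacing [x] by [x + t y] when
    that of [x] is zero. *)
Lemma nilp_comm_union : nilp_comm_var k p = union_upto (comm_piece k p) q.
Proof.
have pE := half_pE; have q0 : (0 < q)%N by move: p_gt3; lia.
apply/seteqP; split=> [[x y] nxy|xy [i /= iq]]; last exact: piece_nilp_comm iq _.
have [/= nx ny xy] := nxy.
have in_piece i : (i <= q)%N -> comm_piece k p i (x, y) ->
  union_upto (comm_piece k p) q (x, y) by exists i.
have line i : (i <= q)%N ->
    (forall t : k, t != 0 -> comm_piece k p i (x + t *: y, y)) ->
    comm_piece k p i (x, y).
  move=> iq H; apply: (@zclosed_line k _ _ _ (y, 0) 'X); first exact: zclosed_piece.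
    by rewrite polyX_eq0.
  move=> t; rewrite hornerX => /H.
  by rewrite -[X in _ -> comm_piece k p i X]/(x + t *: y, y + t *: 0) scaler0 addr0.
have [x0|x0] := eqVneq (coefW 0 x) 0; last first.
  apply: (in_piece 0%N) => //; have -> : y = coefW 0 y / coefW 0 x *: x.
    apply: (coefW_inj pk) => m mp; rewrite coefWZ.
    by apply: (centralizer_coef pk _ _ x0 xy) => //; lia.
  exact: sub_piece0.
have [xz|/eqP xnz] := eqVneq x 0.
  apply: (in_piece 0%N) => //; apply: line => // t t0; rewrite xz add0r.
  rewrite -[X in (_, X)](scalerK t0) /=; apply: sub_piece0.
  apply/(nilpP pk); move/(nilpP pk): ny; rewrite /resid linearZ exprZn coefZ => ->.
  by rewrite mulr0.
have [a [ap vx xa]] := exists_order xnz.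
have x1 := nilp_coef1 pk x0 nx.
have a2 : (1 < a)%N.
  by case: a xa {ap vx} => [|[|a]] //; rewrite ?x0 ?x1 eqxx.
have [aq|qa] := leqP a q.+1.
  apply: (in_piece a.-1); first by lia.
  apply: stratum_piece; [by lia | by lia |].
  by apply: stratumP; rewrite ?prednK //; lia.
have vy : vanish (p - a).+1 (symb y).
  move=> m mpa; rewrite -/(coefW m y) (centralizer_coef pk ap vx xa xy); try lia.
  by rewrite (_ : coefW m x = 0) ?mulr0 //; apply: vx; lia.
have [yz|/eqP ynz] := eqVneq y 0.
  by apply: (in_piece 0%N) => //; rewrite yz -(scale0r x); exact: sub_piece0.
have [b [bp vyb yb]] := exists_order ynz.
have ab : (p - a < b)%N.
  by rewrite ltnNge; apply/negP => bpa; case/eqP: yb; apply: vy.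
have nline (t : k) : nilp_comm_var k p (x + t *: y, y).
  split=> //=; last exact: bracket_line.
  by rewrite addrC; apply: nilp_vanish2; apply: vanish_lin;
    [apply: vanish_le vyb | apply: vanish_le vx]; lia.
have [bq|qb] := leqP b q.+1.
  apply: (in_piece b.-1); first by lia.
  apply: line => [|t t0]; first by lia.
  apply: stratum_piece; [by lia | by lia |].
  apply: stratumP => //; first by lia.
    by rewrite addrC; apply: vanish_lin;
      [apply: vanish_le vyb | apply: vanish_le vx]; lia.
  rewrite prednK; last by lia.
  have xb : coefW b x = 0 by apply: vx; lia.
  by rewrite coefWD coefWZ xb add0r mulf_neq0.
apply: (in_piece q) => //.
have v2 (z : W) : vanish q.+2 (symb z) -> coefW q.+2 z = 0 -> vanish (p - q) (symb z).
  by move=> vz z0; apply: vanish_le (vanishS vz z0); lia.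
have vxq : vanish q.+2 (symb x) by exact: vanish_le vx.
have vyq : vanish q.+2 (symb y) by exact: vanish_le vyb.
have vcomb c : vanish q.+2 (symb (y - c *: x)).
  by rewrite addrC -scaleNr; exact: vanish_lin.
have [xq|xq] := eqVneq (coefW q.+2 x) 0; last first.
  apply: piece_set_piece => //; exists (coefW q.+2 y / coefW q.+2 x); split=> /=.
    exact: vanish_le vxq.
  by apply: v2 => //; rewrite coefWB coefWZ divfK // subrr.
apply: line => // t t0; apply: piece_set_piece => //; exists t^-1; split=> /=.
  by rewrite addrC; apply: vanish_lin;
    [exact: vanish_le (leqnSn _) vyq | exact: vanish_le (leqnSn _) vxq].
rewrite scalerDr scalerA mulVf // scale1r opprD addrCA subrr addr0.
rewrite -scaleNr -[_ *: x]addr0; apply: v2; last by rewrite addr0 coefWZ xq mulr0.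
by apply: vanish_lin vxq _; exact: vanish0.
Qed.

(** If [i < j], some pair in the piece of index [i] has a first member of order at
    most [j], while these orders exceed [j] in the piece of index [j].  If
    [i > j], the piece of index [j] satisfies the vanishing of the minors
    [x_m y_n - x_n y_m] with [m, n < p - j], and the pair
    [(X^(i+1) D, X^(p-i) D)] in the piece of index [i] does not. *)
Lemma piece_not_sub i j : (i <= q)%N -> (j <= q)%N ->
  comm_piece k p i `<=` comm_piece k p j -> i = j.
Proof.
move=> iq jq sub; have pE := half_pE.
case: (ltngtP i j) => // ij; exfalso.
  (* For [i = 0] a pair whose first member has order [0] and not [1] is needed, as
     [X D] is not nilpotent. *)
  pose e := if i == 0%N then 0%N else i.+1.
  have ep : (e < p)%N by rewrite /e; case: eqP; lia.
  have ej : (e <= j)%N by rewrite /e; case: eqP; lia.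
  have : comm_piece k p i (witt_XD k p e, 0).
    rewrite /e; case: posnP => [i0|i0].
      rewrite i0 -(scale0r (witt_XD k p 0)); apply: sub_piece0.
      apply/(nilpP pk); rewrite /resid /symb witt_XD_X // expr0 expr1n.
      by rewrite coef_trunc1 //; case: (p) p_gt3 => [|[|]] //; lia.
    apply: piece_set_piece => //; exists 0; split=> /=.
      by apply: vanish_XD => //; lia.
    by rewrite scale0r subr0; exact: vanish0.
  move/sub; rewrite comm_pieceE // range_piece //; last by lia.
  move/zclosureP => /(_ (fun xy => coefW e xy.1)) H.
  have := H (polyfun_coef1 k p e); rewrite /= coefW_XD // eqxx.
  have eS xy : piece_set j xy -> coefW e xy.1 = 0.
    by case=> c [vx _]; apply: vx; lia.
  by move=> /(_ eS)/eqP; rewrite oner_eq0.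
have : comm_piece k p i (witt_XD k p i.+1, witt_XD k p (p - i)).
  apply: piece_set_piece => //; first by lia.
  exists 0; rewrite /= scale0r subr0; split; apply: vanish_XD; lia.
move/sub; rewrite comm_pieceE // => /zclosureP.
pose minor (xy : WW) :=
  coefW i.+1 xy.1 * coefW (p - i) xy.2 - coefW (p - i) xy.1 * coefW i.+1 xy.2.
have pf : polyfun minor.
  by apply: polyfunB; apply: polyfunM; [exact: polyfun_coef1 | exact: polyfun_coef2
    | exact: polyfun_coef1 | exact: polyfun_coef2].
have minor0 xy : range (@piece_param k p j) xy -> minor xy = 0.
  rewrite /minor; have [->|j0] := posnP j.
    case=> v _ <-; rewrite /piece_param eqxx /= !coefWZ.
    by apply/eqP; rewrite subr_eq0; apply/eqP; rewrite mulrC mulrAC mulrC.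
  rewrite range_piece //; case: xy => x y [c [/= vx vz]].
  have yE m : (m < p - j)%N -> coefW m y = c * coefW m x.
    by move=> mj; apply/eqP; rewrite -subr_eq0 -coefWZ -coefWB; apply/eqP; exact: vz.
  rewrite !yE; [|lia|lia].
  by apply/eqP; rewrite subr_eq0; apply/eqP; rewrite mulrC mulrAC mulrC.
move=> /(_ minor pf minor0) /eqP; rewrite /minor /= !(coefW_XD pk) ?eqxx; try lia.
by rewrite gtn_eqF ?mul1r ?mul0r ?subr0 ?oner_eq0 //; lia.
Qed.

(** For [i > 0] the linear space of the pairs in [g_i] and [g_(p-1-i)] has
    dimension [p - 1] and misses [(e, e)] with [e = X^(i+1) D].  For [i = 0] the
    chain goes from [g_1], of dimension [p - 2], through the nilpotent variety,
    which contains [D], to the whole piece, which contains [(D, D)]. *)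
Lemma irr_chain_piece i : (i <= q)%N -> irr_chain (comm_piece k p i) p.
Proof.
move=> iq; have pE := half_pE; have [i0|i0] := posnP i.
  pose Z1 : set WW := [set xy | vanish 2 (symb xy.1) /\ xy.2 = 0].
  pose Z2 : set WW := zclosure (range (fun v => (@nilp_param k p v, 0 : W))).
  have Z2N x : nilp_var k p x -> Z2 (x, 0).
    move=> nx; apply/zclosureP => g pg gv.
    apply: (nilp_dense pk (g := fun x => g (x, 0))) nx.
      apply: (polyfun_comp (L := fun x : W => (x, 0) : WW)) pg => c u w.
      by rewrite -[RHS]/(c *: u + w, c *: 0 + 0) scaler0 addr0.
    by move=> v; apply: gv; exists v.
  have X0_nilp : nilp_var k p (witt_XD k p 0).
    apply/(nilpP pk); rewrite /resid /symb witt_XD_X // expr0 expr1n.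
    by rewrite coef_trunc1 //; case: (p) p_gt3 => [|[|]] //; lia.
  have X00 : coefW 0 (witt_XD k p 0) = 1 by rewrite coefW_XD //; lia.
  have ch1 : irr_chain Z1 p.-2.
    apply: (@irr_chain_vspace _ _ _ _ (fun b => (witt_XD k p b.+2, 0))
              (fun b xy => coefW b.+2 xy.1)).
    - by move=> b; apply: fst_scalar; exact: coefW_scalar.
    - move=> b b' bp b'b /=; rewrite coefW_XD //; last by lia.
      by rewrite gtn_eqF.
    - by move=> b bp /=; rewrite coefW_XD ?eqxx ?oner_eq0 //; lia.
    - by split=> //=; exact: vanish0.
    - move=> a [x y] [x' y'] [/= vx ->] [/= vx' ->]; split=> /=.
        exact: vanish_lin.
      by rewrite scaler0 addr0.
    - by move=> b bp; split=> //=; apply: vanish_XD => //; lia.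
  have ch2 : irr_chain Z2 p.-2.+1.
    apply: irr_chainS ch1; first exact: zclosed_closure.
    - apply/zirreducible_closure/zirreducible_image/polymap_pair.
        exact: polymap_nilp.
      by move=> l ls; exists (l 0)%:MP => v; rewrite mevalC.
    - by move=> [x y] [/= vx ->]; apply: Z2N; exact: nilp_vanish2.
    - move=> sub; have [/= v1 _] := sub _ (Z2N _ X0_nilp).
      by have /eqP := v1 0%N isT; rewrite -/(coefW 0 _) X00 oner_eq0.
  have pS : p.-2.+2 = p by lia.
  rewrite -[X in irr_chain _ X]pS.
  apply: irr_chainS ch2; first exact: zclosed_piece.
  - exact: zirreducible_piece.
  - rewrite i0; apply: zclosure_sub; first exact: zclosed_piece.
    move=> _ [v _ <-]; rewrite -(scale0r (nilp_param v)); apply: sub_piece0.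
    exact: nilp_nilp_param.
  - rewrite i0 => sub; have := sub _ (sub_piece0 1 X0_nilp).
    move/zclosureP => /(_ (fun xy => coefW 0 xy.2) (polyfun_coef2 k p 0)).
    rewrite /= scale1r X00 => H; have /eqP : (1 : k) = 0; last by rewrite oner_eq0.
    by apply: H => _ [v _ <-] /=; rewrite /coefW linear0 coef0.
pose Z : set WW := [set xy | vanish i.+1 (symb xy.1) /\ vanish (p - i) (symb xy.2)].
have ch : irr_chain Z p.-1.
  apply: (@irr_chain_vspace _ _ _ _
    (fun b => if (b < i)%N then (0, witt_XD k p (p - i + b)) else (witt_XD k p b.+1, 0))
    (fun b xy => if (b < i)%N then coefW (p - i + b) xy.2 else coefW b.+1 xy.1)).
  - move=> b; case: (b < i)%N; first by apply: snd_scalar; exact: coefW_scalar.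
    by apply: fst_scalar; exact: coefW_scalar.
  - move=> b b' bp b'b.
    have coefW0 m : coefW m (0 : W) = 0 by rewrite /coefW linear0 coef0.
    case: (ltnP b i) => bi; case: (ltnP b' i) => b'i //=; try by lia.
      by rewrite coefW_XD; [rewrite gtn_eqF // ltn_add2l | exact: pk | lia].
    by rewrite coefW_XD; [rewrite gtn_eqF | exact: pk | lia].
  - move=> b bp; case: ltnP => bi /=; rewrite coefW_XD ?eqxx ?oner_eq0 //; lia.
  - by split; exact: vanish0.
  - move=> a [x y] [x' y'] [/= vx vy] [/= vx' vy'].
    by split=> /=; exact: vanish_lin.
  - move=> b bp; case: ltnP => bi; split=> /=; try exact: vanish0;
      apply: vanish_XD; lia.
have pS : p.-1.+1 = p by lia.
rewrite -[X in irr_chain _ X]pS.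
apply: irr_chainS ch; first exact: zclosed_piece.
- exact: zirreducible_piece.
- move=> [x y] [/= vx vy]; apply: piece_set_piece => //; exists 0.
  by rewrite scale0r subr0.
move=> sub; have [|_ /= H] := sub (witt_XD k p i.+1, witt_XD k p i.+1).
  apply: piece_set_piece => //; exists 1; split=> /=.
    by apply: vanish_XD => //; lia.
  by rewrite scale1r subrr; exact: vanish0.
have /eqP : coefW i.+1 (witt_XD k p i.+1) = 0 by apply: H; lia.
by rewrite coefW_XD // ?eqxx ?oner_eq0 //; lia.
Qed.

Lemma zdim_piece i : (i <= q)%N -> zdim_is (comm_piece k p i) p.
Proof.
move=> iq; split; first exact: irr_chain_piece.
by move=> n; rewrite comm_pieceE //; apply: irr_chain_image; exact: polymap_piece.
Qed.

End Decomposition.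

Theorem theorem3p6 (k : closedFieldType) (p : nat)
    (hchar : p \in [pchar k]) (hp : (3 < p)%N) :
  [/\ ~ zirreducible (nilp_comm_var k p),
      equidimensional (nilp_comm_var k p),
      nilp_comm_var k p =
        \bigcup_(i in [set i : nat | (i <= (p - 3)./2)%N]) comm_piece k p i,
      forall i j : nat, (i <= (p - 3)./2)%N -> (j <= (p - 3)./2)%N ->
        i <> j -> comm_piece k p i <> comm_piece k p j
    & forall Y : set (witt k p * witt k p)%type,
        irr_component (nilp_comm_var k p) Y <->
        exists i : nat, (i <= (p - 3)./2)%N /\ Y = comm_piece k p i].
Proof.
have ninc := piece_not_sub hchar hp.
have union := nilp_comm_union hchar hp.
have comp Y : irr_component (nilp_comm_var k p) Y <->
    exists i : nat, (i <= (p - 3)./2)%N /\ Y = comm_piece k p i.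
  rewrite union; apply: irr_component_union_upto => // i.
  - exact: zclosed_piece.
  - exact: zirreducible_piece.
split=> //.
- rewrite union => irr; have [i iq sub] := zirreducible_union_upto irr
    (@zclosed_piece k p) (fun v => id).
  have piece_sub j : (j <= (p - 3)./2)%N -> comm_piece k p j `<=` comm_piece k p i.
    by move=> jq v vj; apply: sub; exists j.
  have q0 : (0 < (p - 3)./2)%N.
    by have := half_pE hchar hp; move: hp; lia.
  have /ninc i0 := piece_sub 0%N isT; have /ninc i1 := piece_sub 1%N q0.
  by have := i1 q0 iq; rewrite -(i0 isT iq).
- by exists p => Y /comp[i [iq ->]]; exact: zdim_piece.
- by move=> i j iq jq ij eij; apply: ij; apply: ninc => //; rewrite eij.
Qed.
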